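(* Let $\mathbf{G}=(J,\mu,E)$ be a graphing and let $\alpha\in\mathsf{bmm}_+(\rho_{\mathbf{G}})$ with Radon–Nikodym derivative $f_\alpha=\frac{d\alpha}{d\eta_{\mathbf{G}}}$. Suppose $f_\alpha$ is exposed by a function $g\in L^\infty(E,\eta_{\mathbf{G}})$, i.e. $\int_E f_\alpha g\,d\eta_{\mathbf{G}}>\int_E f_\beta g\,d\eta_{\mathbf{G}}$ for every $\beta\in\mathsf{bmm}_+(\rho_{\mathbf{G}})$ with $f_\beta\ne f_\alpha$ in $L^1(E,\eta_{\mathbf{G}})$. Then $f_\alpha$ is $\{0,1\}$-valued $\eta_{\mathbf{G}}$-almost everywhere.
   Context: A graphing $\mathbf{G}=(J,\mu,E)$: $(J,\mu)$ a standard Borel probability space, $E\subseteq\binom{J}{2}$ Borel with bounded degrees, satisfying $\int_A\deg(B,x)\,d\mu(x)=\int_B\deg(A,x)\,d\mu(x)$ for all measurable $A,B\subseteq J$. Edge measure: $\eta_{\mathbf{G}}(F)=\frac12\int_J\deg_F(x)\,d\mu(x)$. Rank: $\rho_{\mathbf{G}}(F)=1-\int_J\frac{1}{|V(\mathbf{G}^F_x)|}\,d\mu(x)$, where $\mathbf{G}^F_x$ is the component of $x$ in $(J,\mu,F)$ and $1/\infty=0$. $\mathsf{mm}_+(\rho_{\mathbf{G}})$ is the set of measures $\alpha$ on $E$ with $0\le\alpha(A)\le\rho_{\mathbf{G}}(A)$ for all Borel $A$ (these satisfy $\alpha\le\eta_{\mathbf{G}}$, hence have Radon–Nikodym derivatives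 w.r.t. $\eta_{\mathbf{G}}$), and $\mathsf{bmm}_+(\rho_{\mathbf{G}})=\{\alpha\in\mathsf{mm}_+(\rho_{\mathbf{G}}):\alpha(E)=\rho_{\mathbf{G}}(E)\}$. *)

(* Defs.v *)
From HB Require Import structures.
From mathcomp Require Import all_boot all_order all_algebra.
From mathcomp Require Import finmap.
From mathcomp Require Import all_classical all_reals all_analysis.
From Stdlib Require Import Relations.
Set Implicit Arguments. Unset Strict Implicit. Unset Printing Implicit Defensive.
Import Order.TTheory GRing.Theory Num.Theory.
Local Open Scope fset_scope.
Local Open Scope classical_set_scope.
Local Open Scope ring_scope.

Section Graphing.
Context (d : measure_display) (J : measurableType d) (R : realType).

(* Standard Borel: Borel isomorphic to a Borel subset of R (Kuratowski). *)
Definition standard_borel : Prop :=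
  exists phi : J -> R,
    [/\ measurable_fun setT phi, injective phi, measurable (range phi)
      & forall A, measurable A -> measurable (phi @` A)].

(* The edge relation adj (E is the set of unordered pairs {x,y} with adj x y);
   subsets of E are encoded as symmetric subsets of J*J contained in Edir. *)
Definition Edir (adj : J -> J -> Prop) : set (J * J) := [set p | adj p.1 p.2].

Definition edge_subset (adj : J -> J -> Prop) (F : set (J * J)) : Prop :=
  [/\ measurable F, F `<=` Edir adj & forall x y, F (x, y) -> F (y, x)].

Definition nbrE (F : set (J * J)) (x : J) : set J := [set y | F (x, y)].
Definition degE (F : set (J * J)) (x : J) : nat := #|` fset_set (nbrE F x) |.

Definition deg (adj : J -> J -> Prop) (B : set J) (x : J) : nat :=
  degE [set p | adj p.1 p.2 /\ B p.2] x.

Definition is_graphing (mu : probability J R) (adj : J -> J -> Prop) : Prop :=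
  [/\ standard_borel,
      measurable (Edir adj) /\
      (forall x y, adj x y -> adj y x),
      (forall x, ~ adj x x),
      (exists D : nat, forall x, finite_set (nbrE (Edir adj) x) /\
                                 (degE (Edir adj) x <= D)%N)
    & forall A B, measurable A -> measurable B ->
        (\int[mu]_(x in A) ((deg adj B x)%:R : R)%:E =
         \int[mu]_(x in B) ((deg adj A x)%:R : R)%:E)%E].

Definition eta (mu : probability J R) (F : set (J * J)) : \bar R :=
  ((2^-1 : R)%:E * \int[mu]_x ((degE F x)%:R : R)%:E)%E.

Definition comp (F : set (J * J)) (x : J) : set J :=
  [set y | clos_refl_trans J (fun a b => F (a, b)) x y].

(* 1 / |V(G^F_x)| with 1/oo = 0 *)
Definition inv_comp (F : set (J * J)) (x : J) : R :=
  if `[< finite_set (comp F x) >] then ((#|` fset_set (comp F x) |)%:R)^-1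
  else 0.

Definition rank (mu : probability J R) (F : set (J * J)) : \bar R :=
  (1 - \int[mu]_x (inv_comp F x)%:E)%E.

(* integral over E w.r.t. eta_G of a function h on E (h symmetric on Edir):
   int_E h deta = 1/2 int_J sum_{y ~ x} h(x,y) dmu(x) *)
Definition eta_int (mu : probability J R) (adj : J -> J -> Prop) (h : J * J -> R) : \bar R :=
  ((2^-1 : R)%:E * \int[mu]_x (\sum_(y \in nbrE (Edir adj) x) h (x, y))%:E)%E.

Definition edge_measure (adj : J -> J -> Prop) (a : set (J * J) -> \bar R) : Prop :=
  [/\ a set0 = 0%E,
      (forall F, edge_subset adj F -> (0 <= a F)%E)
    & forall Fs : nat -> set (J * J), (forall n, edge_subset adj (Fs n)) ->
        trivIset setT Fs ->
        ((fun n => \sum_(0 <= i < n) a (Fs i))%E @ \oo --> a (\bigcup_n Fs n))].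

Definition mm_plus (mu : probability J R) adj (a : set (J * J) -> \bar R) : Prop :=
  edge_measure adj a /\
  forall A, edge_subset adj A -> (0 <= a A)%E /\ (a A <= rank mu A)%E.

Definition bmm_plus (mu : probability J R) adj (a : set (J * J) -> \bar R) : Prop :=
  mm_plus mu adj a /\ a (Edir adj) = rank mu (Edir adj).

Definition eta_ae (mu : probability J R) adj (P : J * J -> Prop) : Prop :=
  exists N, [/\ edge_subset adj N, eta mu N = 0%E &
                forall p, Edir adj p -> ~ N p -> P p].

(* f is (a version of) the Radon-Nikodym derivative d a / d eta_G,
   as a function on E (= symmetric function on Edir) *)
Definition is_RN_deriv (mu : probability J R) adj (a : set (J * J) -> \bar R)
    (f : J * J -> R) : Prop :=
  [/\ measurable_fun (Edir adj) f,
      (forall x y, f (x, y) = f (y, x))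
    & forall F, edge_subset adj F -> a F = eta_int mu adj (fun p => \1_F p * f p)].

Definition Linfty_E (mu : probability J R) adj (g : J * J -> R) : Prop :=
  [/\ measurable_fun (Edir adj) g,
      (forall x y, g (x, y) = g (y, x))
    & exists M : R, eta_ae mu adj (fun p => `|g p| <= M)].

End Graphing.

(* Main.v *)
From HB Require Import structures.
From mathcomp Require Import finmap.
From mathcomp Require Import all_boot all_order all_algebra.
From mathcomp Require Import all_classical all_reals all_analysis.
From mathcomp Require Import measurable_realfun lra.
From Stdlib Require Import Relations.
Require Import Defs.
Set Implicit Arguments. Unset Strict Implicit. Unset Printing Implicit Defensive.
Import Order.TTheory GRing.Theory Num.Theory.
Import numFieldNormedType.Exports.
Local Open Scope classical_set_scope.
Local Open Scope ring_scope.

(** By exposure it suffices to find a Borel set F of edges such that its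
    indicator is the density of a member of bmm_+ and maximises the integral
    against g among such densities: the given derivative then agrees with the
    indicator of F almost everywhere.

    F is the wired maximum spanning forest of the graphing for a Borel total
    order on edges that refines g: an edge xy is kept if x and y lie in different
    components of the graph of the edges above xy, at least one of them finite.
    The same rule applied to any Borel set A of edges gives a forest F_A with
    eta(F_A) = rank(A).  Indeed let every vertex z send to every edge p of A the
    mass by which 1/|component of z| drops when p is added to the edges above p.
    An edge of F_A receives 1 and any other edge receives 0, while z sends out
    1 - 1/|component of z in A| in total, so the mass transport principle gives
    the equality.  As A inter F is contained in F_A, the measure with density the
    indicator of F is in bmm_+; as A inter F = F_A for A = {g >= t}, it gives the
    largest possible value to every level set of g, hence to the integral of g.

    Measurability rests on the Lusin-Novikov theorem: the edge set is covered by
    the graphs of countably many Borel maps.  It is deduced from Novikov's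
    separation theorem for analytic sets, applied to points coded by the rational
    cuts of a Borel injection into the reals. *)

(** * Borel and analytic sets of sequences *)

(** The order on edges need not have a first edge, so no greedy procedure can be run step by step;
    membership in F is a condition on the edges above a single edge instead. The accounting rests on
    local finiteness: writing 1/N as the sum of 1/(n+1) - 1/(n+2) over n >= N - 1, the mass sent by
    z is paid threshold by threshold, and for each n with n + 1 below the size of the component of z
    in A exactly one edge makes that component outgrow n + 1. The wiring is forced by 1/oo = 0:
    joining two infinite components lowers nothing, while joining a finite component to an infinite
    one releases all the reciprocals of the finite one, that is 1. Members of bmm_+ share the same
    total mass, so g may be shifted by a constant and made non-negative, as the level set argument
    requires. The countable family of Borel maps has a second use: it turns the balance of degrees,
    which concerns single edges, into mass transport along words, hence inside whole components. *)

Section BorelCodes.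
Variable L : Type.
Implicit Types (S : set (nat -> L)).

(** There is no constructor for complements: the complement of a cylinder is a cylinder, so closure
    under complement is derived, and the induction that proves Borel sets analytic has no complement
    case. *)
Inductive bor : set (nat -> L) -> Prop :=
| bor_cyl n (Q : L -> Prop) : bor [set u | Q (u n)]
| bor_bigcup (F : nat -> set (nat -> L)) :
    (forall n, bor (F n)) -> bor (\bigcup_n F n)
| bor_bigcap (F : nat -> set (nat -> L)) :
    (forall n, bor (F n)) -> bor (\bigcap_n F n).

Lemma bor_const (Q : Prop) : bor [set _ | Q].
Proof. exact: (bor_cyl 0 (fun=> Q)). Qed.

Lemma borC S : bor S -> bor (~` S).
Proof.
elim=> {S} [n Q|F _ ih|F _ ih].
- exact: (bor_cyl n (fun l => ~ Q l)).
- by rewrite setC_bigcup; exact: bor_bigcap.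
- by rewrite setC_bigcap; exact: bor_bigcup.
Qed.

Lemma bor_ex (I : countType) (F : I -> set (nat -> L)) :
  (forall i, bor (F i)) -> bor [set u | exists i, F i u].
Proof.
move=> bF; rewrite [X in bor X](_ : _ = \bigcup_n
    [set u | (exists2 i : I, unpickle n = Some i & F i u)]).
  apply: bor_bigcup => n; case: (unpickle n) => [i|].
    rewrite [X in bor X](_ : _ = F i)//.
    by apply/seteqP; split=> [u [j [->]]//|u Fu]; exists i.
  rewrite [X in bor X](_ : _ = [set _ | False]); first exact: bor_const.
  by apply/seteqP; split=> [u [j []]//|u].
apply/seteqP; split=> [u [i Fu]|u [n _ [i _ Fu]]]; last by exists i.
by exists (pickle i) => //; exists i => //; rewrite pickleK.
Qed.

Lemma bor_all (I : countType) (F : I -> set (nat -> L)) :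
  (forall i, bor (F i)) -> bor [set u | forall i, F i u].
Proof.
move=> bF; have := borC (bor_ex (fun i => borC (bF i))).
congr bor; apply/seteqP; split=> u /=.
  by move=> nF i; apply: contrapT => nFi; apply: nF; exists i.
by move=> aF [i]; apply.
Qed.

Lemma borU S S' : bor S -> bor S' -> bor (S `|` S').
Proof.
move=> bS bS'; have : bor [set u | exists b : bool, (if b then S else S') u].
  by apply: bor_ex => -[].
congr bor; apply/seteqP; split=> u /=; first by case=> -[]; [left|right].
by case=> ?; [exists true|exists false].
Qed.

Lemma borI S S' : bor S -> bor S' -> bor (S `&` S').
Proof.
move=> bS bS'; have := borC (borU (borC bS) (borC bS')).
by rewrite setCU !setCK.
Qed.

(* The closed subsets of (nat -> L) * (nat -> K) for discrete L and K. *)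
Definition closedP (K : Type) (P : (nat -> L) -> (nat -> K) -> Prop) :=
  forall u s, (forall n, exists u' s', P u' s' /\
     forall k, (k < n)%N -> u' k = u k /\ s' k = s k) -> P u s.

Definition analytic (K : Type) S := exists P : (nat -> L) -> (nat -> K) -> Prop,
  closedP P /\ forall u, S u <-> exists s, P u s.

(** For a union, the first entry of the witness names the index and the rest is a witness for that
    set. For an intersection, one sequence interleaves witnesses for all the sets through
    [pickle (i, n)]. *)
Lemma bor_analytic S : bor S -> analytic nat S.
Proof.
elim=> {S} [n Q|F _ ih|F _ ih].
- exists (fun u _ => Q (u n)); split.
    by move=> u s /(_ n.+1)[u' [s' [Qu' /(_ n (ltnSn n))[<- _]]]].
  by move=> u; split=> [?|[]//]; exists (fun=> 0%N).
- have [P PP] := choice ih.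
  exists (fun u s => P (s 0%N) u (fun k => s k.+1)); split.
    move=> u s cP; apply: (PP _).1 => n.
    have [u' [s' [Pu' E]]] := cP n.+1.
    have [_ s0] := E 0%N isT.
    exists u', (fun k => s' k.+1); split; first by rewrite -s0.
    by move=> k kn; split; [exact: (E k (ltnW kn)).1|exact: (E k.+1 kn).2].
  move=> u; split=> [[n _ /(PP n).2[s Ps]]|[s Ps]].
    by exists (fun k => if k is k'.+1 then s k' else n).
  by exists (s 0%N) => //; apply/(PP _).2; exists (fun k => s k.+1).
- have [P PP] := choice ih.
  exists (fun u s => forall i, P i u (fun n => s (pickle (i, n)))); split.
    move=> u s cP i; apply: (PP i).1 => n.
    (* Agreement up to N controls the first n entries of the i-th interleaved witness. *)
    pose N := (maxn n (\max_(k < n) (pickle (i, k : nat)).+1)).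
    have [u' [s' [Pu' E]]] := cP N.
    exists u', (fun n => s' (pickle (i, n))); split=> [//|k kn]; split.
      by apply: (E k _).1; rewrite leq_max kn.
    apply: (E _ _).2; rewrite leq_max; apply/orP; right.
    exact: (leq_bigmax (Ordinal kn)).
  move=> u; split=> [Fu|[s Ps] i _]; last first.
    by apply/(PP i).2; eexists; exact: Ps.
  have /choice[s Ps] : forall i, exists s, P i u s.
    by move=> i; apply/(PP i).2; exact: Fu.
  exists (fun m => if unpickle m is Some (i, n) then s i n else 0%N) => i.
  have -> // : (fun n => if unpickle (pickle (i, n)) is Some (j, n')
                      then s j n' else 0%N) = s i.
  by apply/funext => n; rewrite pickleK.
Qed.

End BorelCodes.

(** * Novikov separation of finitely many analytic sets without common point *)

Section NovikovSeparation.
Variables (k : nat) (L K : countType).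
Variable P : 'I_k.+1 -> (nat -> L) -> (nat -> K) -> Prop.
Hypothesis closed_P : forall i, closedP (P i).

Let separated (A : 'I_k.+1 -> set (nat -> L)) := exists B : 'I_k.+1 -> set (nat -> L),
  [/\ forall i, bor (B i), forall i, A i `<=` B i & forall u, ~ forall i, B i u].

Let word := {ffun 'I_k.+1 -> L * K}.

(** A single list of words restricts all k+1 sets at once: the i-th letters of its words prescribe
    the beginning of a point of the i-th set together with its witness. *)
Let piece (s : seq word) (i : 'I_k.+1) : set (nat -> L) :=
  [set u | exists t, P i u t /\ forall j w, (j < size s)%N ->
     (u j, t j) = nth w s j i].

Let piece_split s i u : piece s i u ->
  exists l, forall w : word, w i = l -> piece (rcons s w) i u.
Proof.
case=> t [Pt E]; exists (u (size s), t (size s)) => w wi.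
exists t; split=> // j w'; rewrite size_rcons ltnS leq_eqVlt nth_rcons.
by case/predU1P => [->|js]; rewrite ?ltnn ?eqxx ?wi// js (E j w').
Qed.

(** If every extension by one word were separated by some [B w], take for index i the union over
    letters l of the intersection of the [B w i] with [w i = l]. A common point would choose one
    letter per index; the word made of these letters then contradicts the choice of [B w]. *)
Let piece_step s : ~ separated (piece s) ->
  exists w, ~ separated (piece (rcons s w)).
Proof.
move=> nsep; apply: contrapT => allsep; apply: nsep.
have /choice[B sepB] : forall w : word, exists B : 'I_k.+1 -> set (nat -> L),
    [/\ forall i, bor (B i), forall i, piece (rcons s w) i `<=` B i &
        forall u, ~ forall i, B i u].
  by move=> w; apply: contrapT => nB; apply: allsep; exists w.
exists (fun i => [set u | exists l : (L * K)%type, forall w : word, w i = l -> B w i u]).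
split=> [i|i u /piece_split[l lP]|u uB].
- apply: bor_ex => l; apply: bor_all => w.
  have [E|E] := eqVneq (w i) l.
    rewrite [X in bor X](_ : _ = B w i); first by have [] := sepB w.
    by apply/seteqP; split=> u /=; [apply|].
  rewrite [X in bor X](_ : _ = [set _ | True]); first exact: bor_const.
  by apply/seteqP; split=> u //= _ wl; rewrite wl eqxx in E.
- by exists l => w wl; have [_ + _] := sepB w; apply; exact: lP.
- have [l lP] := choice uB.
  have [_ _ /(_ u)] := sepB [ffun i => l i].
  by apply=> i; apply: lP; rewrite ffunE.
Qed.

Let separated_set0 (A : 'I_k.+1 -> set (nat -> L)) i : A i = set0 -> separated A.
Proof.
move=> A0; exists (fun j => [set _ | j != i]); split=> [j|j u Au|u]; last 2 first.
- by apply/eqP => E; move: Au; rewrite E A0.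
- by move/(_ i); rewrite /= eqxx.
exact: bor_const.
Qed.

(** Otherwise [piece_step] yields an infinite branch of non-separated pieces. It spells a point
    [u i] with a witness [t i] for each i, and closedness puts them in [P i]. If all these points
    agree they form a common point; if two differ, some finite stage of the branch is separated by
    cylinders. *)
Lemma novikov_separation : (forall u, ~ forall i, exists s, P i u s) ->
  exists B : 'I_k.+1 -> set (nat -> L),
  [/\ forall i, bor (B i), forall i u s, P i u s -> B i u &
      forall u, ~ forall i, B i u].
Proof.
move=> disj; suff : separated (piece [::]).
  case=> B [bB sB dB]; exists B; split=> // i u s Pus.
  by apply: sB; exists s; split.
apply: contrapT => nsep.
have /choice[w wP] : forall s : {s | ~ separated (piece s)}, exists w,
    ~ separated (piece (rcons (sval s) w)).
  by case=> s ns; exact: piece_step.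
pose next s : {s | ~ separated (piece s)} := exist _ (rcons (sval s) (w s)) (wP s).
pose st n := iter n next (exist _ [::] nsep).
have size_st n : size (sval (st n)) = n by elim: n => //= n ih; rewrite size_rcons ih.
have nth_st x n j : (j < n)%N -> nth x (sval (st n)) j = w (st j).
  elim: n => //= n ih; rewrite nth_rcons size_st ltnS leq_eqVlt.
  by case/predU1P => [->|jn]; rewrite ?ltnn ?eqxx// jn ih.
pose u i j := (w (st j) i).1; pose t i j := (w (st j) i).2.
have pieceE n i v : piece (sval (st n)) i v -> exists t', P i v t' /\
    forall j, (j < n)%N -> v j = u i j /\ t' j = t i j.
  case=> t' [Pt' E]; exists t'; split=> // j jn.
  have := E j (w (st j)); rewrite size_st => /(_ jn).
  by rewrite nth_st// /u /t => <-.
have Put i : P i (u i) (t i).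
  apply: closed_P => n; have [v pv] : piece (sval (st n)) i !=set0.
    by apply/set0P/eqP => p0; exact: (svalP (st n)) (separated_set0 p0).
  by have [t' [? ?]] := pieceE _ _ _ pv; exists v, t'.
have [uE|] := pselect (forall i, u i = u ord0).
  by apply: (disj (u ord0)) => i; exists (t i); rewrite -[in P i _ _](uE i).
move=> /existsNP[i] uNE; have [n un] : exists n, u i n != u ord0 n.
  apply: contrapT => nE; apply: uNE; apply/funext => n; apply/eqP.
  by apply: contrapT => /negP ?; apply: nE; exists n.
apply: (svalP (st n.+1)).
(* Cylinders at coordinate n for the indices i and 0, the whole space elsewhere; stage [n.+1] is the
   first to prescribe that coordinate. *)
exists (fun j v => (j = i -> v n = u i n) /\ (j = ord0 -> v n = u ord0 n)).
split=> [j|j v /pieceE[t' [_ /(_ n (ltnSn n))[-> _]]]|v vB].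
- exact: (bor_cyl n (fun x => (j = i -> x = u i n) /\ (j = ord0 -> x = u ord0 n))).
- by split=> ->.
- have [/(_ erefl) + _] := vB i; have [_ /(_ erefl) ->] := vB ord0.
  by move=> E; rewrite E eqxx in un.
Qed.

End NovikovSeparation.

(** * Coding reals by rational cuts *)

Section RealCodes.
Context {R : realType}.

Definition rat_of_nat n : rat := odflt 0 (unpickle n).

Definition cut_code (r : R) : nat -> bool := fun n => r < ratr (rat_of_nat n).

Lemma rat_of_nat_surj q : exists n, rat_of_nat n = q.
Proof. by exists (pickle q); rewrite /rat_of_nat pickleK. Qed.

Lemma cut_codeP (r s : R) : r < s -> exists n, cut_code r n /\ ~~ cut_code s n.
Proof.
move=> /rat_in_itvoo[q]; rewrite in_itv/= => /andP[rq qs].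
have [n nq] := rat_of_nat_surj q.
by exists n; rewrite /cut_code nq rq -leNgt ltW.
Qed.

Lemma cut_code_inj : injective cut_code.
Proof.
suff H (r s : R) : cut_code r = cut_code s -> ~ r < s.
  move=> r s E; have := H _ _ E; have := H _ _ (esym E).
  by case: ltgtP.
by move=> E /cut_codeP[n []]; rewrite E => ->.
Qed.

(** The codes are the non-empty proper up-sets of rationals without least element, four countable
    conditions. The absence of a least element matches the strict inequality in [cut_code]. *)
Lemma bor_range_cut_code : bor (range cut_code).
Proof.
pose C := [set u : nat -> bool | exists n, u n] `&`
  [set u : nat -> bool | exists n, ~ u n] `&`
  [set u : nat -> bool | forall nm : nat * nat,
    (rat_of_nat nm.1 <= rat_of_nat nm.2 -> u nm.1 -> u nm.2)] `&`
  [set u : nat -> bool | forall n, ~ u n \/ exists m,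
    (rat_of_nat m < rat_of_nat n) /\ u m].
suff -> : range cut_code = C.
  apply: borI; [apply: borI; [apply: borI|]|].
  - by apply: bor_ex => n; exact: (bor_cyl n is_true).
  - by apply: bor_ex => n; exact: (bor_cyl n (fun b => ~ is_true b)).
  - apply: bor_all => -[n m]/=.
    have [le|nle] := pselect (rat_of_nat n <= rat_of_nat m).
      rewrite [X in bor X](_ : _ = [set u : nat -> bool | ~ u n] `|` [set u : nat -> bool | u m]).
        by apply: borU; [exact: (bor_cyl n (fun b => ~ is_true b))|exact: (bor_cyl m is_true)].
      apply/seteqP; split=> [u /(_ le) H|u [nu|um] _ //].
      by have [un|] := pselect (is_true (u n)); [right; exact: H|left].
    rewrite [X in bor X](_ : _ = [set _ | True]); first exact: bor_const.
    by apply/seteqP; split=> [//|u _ /= /nle].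
  - apply: bor_all => n; apply: borU.
      exact: (bor_cyl n (fun b => ~ is_true b)).
    by apply: bor_ex => m; exact: (bor_cyl m (fun b => _ /\ is_true b)).
apply/seteqP; split=> [_ [r _ <-]|u [[[[n un] [m um]] mono] op]].
  split; [split; [split|]|] => /=.
  - have [n [rn _]] := @cut_codeP r (r + 1) (ltac:(by rewrite ltr_pwDr)).
    by exists n.
  - have [n [_ rn]] := @cut_codeP (r - 1) r (ltac:(by rewrite ltrBlDr ltr_pwDr)).
    by exists n; apply/negP.
  - by move=> [n m]/= le rn; apply: lt_le_trans rn _; rewrite ler_rat.
  - move=> n; have [rn|] := pselect (is_true (cut_code r n)); last by left.
    right; have [q] := rat_in_itvoo rn; rewrite in_itv/= => /andP[rq qn].
    have [m mq] := rat_of_nat_surj q; exists m.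
    by rewrite /cut_code mq rq; split=> //; rewrite -(ltr_rat R).
pose S := [set (ratr (rat_of_nat i) : R) | i in [set i | u i]].
have lbS : lbound S (ratr (rat_of_nat m)).
  move=> _ [i /= ui <-]; rewrite ler_rat leNgt; apply/negP => /ltW le.
  by apply: um; exact: (mono (i, m)).
(* The real is recovered as the infimum of its cut. *)
exists (inf S) => //; apply/funext => i; apply/idP/idP => [|ui].
  have S0 : S !=set0 by exists (ratr (rat_of_nat n)), n.
  rewrite /cut_code => /(inf_lt S0)[_ [j /= uj <-]].
  by rewrite ltr_rat => /ltW le; exact: (mono (j, i)).
have [//|[j [ji uj]]] := op i.
apply: (@le_lt_trans _ _ (ratr (rat_of_nat j))); last by rewrite ltr_rat.
apply: ge_inf; last by exists j.
by exists (ratr (rat_of_nat m)).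
Qed.

(** Injectivity turns the image of a complement into a complement relative to the range, which is
    why the range itself has to be Borel. *)
Lemma sigma_algebra_bor_image T L (c : T -> nat -> L) : injective c ->
  bor (range c) -> sigma_algebra setT [set S : set T | bor (c @` S)].
Proof.
move=> inj_c bc; split=> [|S bS|F bF] /=.
- by rewrite image_set0; have := @bor_const L False; congr bor; apply/seteqP; split.
- rewrite setTD [X in bor X](_ : _ = range c `&` ~` (c @` S)).
    by apply: borI => //; exact: borC.
  apply/seteqP; split=> [_ [x nSx <-]|_ [[x _ <-] nSx]].
    by split; [exists x|move=> [y Sy /inj_c yx]; apply: nSx; rewrite -yx].
  by exists x => // Sx; apply: nSx; exists x.
- by rewrite image_bigcup; exact: bor_bigcup.
Qed.

Lemma bor_cut_code (S : set R) : measurable S -> bor (cut_code @` S).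
Proof.
have salg := sigma_algebra_bor_image cut_code_inj bor_range_cut_code.
move=> mS; have {}mS : <<s @measurable_realfun.RGenInftyO.G R >> S.
  exact: (eq_ind _ (fun M : set (set R) => M S) mS _
    (measurable_realfun.RGenInftyO.measurableE R)).
apply: (smallest_sub salg _ mS) => _ [x ->]/=.
rewrite [X in bor X](_ : _ = range cut_code `&`
    [set u | exists n, (ratr (rat_of_nat n) < x) /\ u n]).
  apply: borI; first exact: bor_range_cut_code.
  by apply: bor_ex => n; exact: (bor_cyl n (fun b => _ /\ is_true b)).
apply/seteqP; split=> [_ [r /= rx <-]|u].
  move: rx; rewrite in_itv/= => rx; split; first by exists r.
  have [q] := rat_in_itvoo rx; rewrite in_itv/= => /andP[rq qx].
  by have [n nq] := rat_of_nat_surj q; exists n; rewrite /cut_code nq.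
by case=> -[r _ <-] [n [nx rn]]; exists r => //=; rewrite in_itv/=; exact: lt_trans nx.
Qed.

End RealCodes.

(** * The Lusin-Novikov theorem *)

Lemma bor_comp_letter (L L' : Type) (f : L' -> L) (S : set (nat -> L)) :
  bor S -> bor [set u : nat -> L' | S (f \o u)].
Proof.
elim=> {S} [n Q|F _ ih|F _ ih].
- exact: (bor_cyl n (fun l => Q (f l))).
- exact: (bor_bigcup ih).
- exact: (bor_bigcap ih).
Qed.

Lemma bor_preimage d (X : measurableType d) (L : Type) (H : X -> nat -> L)
  (S : set (nat -> L)) : (forall n Q, measurable [set x | Q (H x n)]) ->
  bor S -> measurable [set x | S (H x)].
Proof.
move=> mH; elim=> {S} [n Q|F _ ih|F _ ih].
- exact: mH.
- rewrite [X in measurable X](_ : _ = \bigcup_n [set x | F n (H x)])//.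
  exact: bigcupT_measurable.
- rewrite [X in measurable X](_ : _ = \bigcap_n [set x | F n (H x)])//.
  exact: bigcapT_measurable.
Qed.

Lemma measurable_exists d (X : measurableType d) (I : countType)
  (F : I -> set X) : (forall i, measurable (F i)) ->
  measurable [set x | exists i, F i x].
Proof.
move=> mF; rewrite [X in measurable X](_ : _ = \bigcup_n
    (if unpickle n is Some i then F i else set0)).
  by apply: bigcupT_measurable => n; case: unpickle.
apply/seteqP; split=> [x [i Fx]|x [n _]].
  by exists (pickle i) => //; rewrite pickleK.
by case: unpickle => // i Fx; exists i.
Qed.

Lemma measurable_forall d (X : measurableType d) (I : countType)
  (F : I -> set X) : (forall i, measurable (F i)) ->
  measurable [set x | forall i, F i x].
Proof.
move=> mF; rewrite [X in measurable X](_ : _ = ~` [set x | exists i, (~` F i) x]).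
  by apply/measurableC/measurable_exists => i; exact: measurableC.
apply/seteqP; split=> [x Fx [i]|x nF i]; first exact.
by apply: contrapT => nFi; apply: nF; exists i.
Qed.

Lemma measurable_prop d (X : measurableType d) (Q : Prop) :
  measurable [set _ : X | Q].
Proof.
have [q|nq] := pselect Q.
  by rewrite [X in measurable X](_ : _ = setT)//; apply/seteqP; split.
by rewrite [X in measurable X](_ : _ = set0)//; apply/seteqP; split.
Qed.

Lemma measurable_bool_pred d (X : measurableType d) (b : X -> bool)
  (Q : bool -> Prop) : measurable [set x | b x] -> measurable [set x | Q (b x)].
Proof.
move=> mb; rewrite [X in measurable X](_ : _ = ([set x | b x] `&` [set _ | Q true])
    `|` (~` [set x | b x] `&` [set _ | Q false])).
  by apply: measurableU; apply: measurableI => //;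
     [exact: measurable_prop|exact: measurableC|exact: measurable_prop].
apply/seteqP; split=> x /=; case: (b x).
- by left.
- by right.
- by case=> -[].
- by case=> -[].
Qed.

Definition in_cylinder (v : nat -> bool) (s : seq bool) :=
  forall j, (j < size s)%N -> v j = nth false s j.

Definition incompatible (s t : seq bool) :=
  exists j, [/\ (j < size s)%N, (j < size t)%N & nth false s j <> nth false t j].

(* Along v, either W eventually contains only prefixes of v, or infinitely many
   branches leaving v can be selected, and these are pairwise incompatible. *)
Lemma isolated_branch (D : nat) (W : set (seq bool)) (v : nat -> bool) :
  (forall t : {ffun 'I_D.+1 -> seq bool},
     (forall i j : 'I_D.+1, (i < j)%N -> incompatible (t i) (t j)) ->
     ~ forall i, W (t i)) ->
  exists n, forall s, (n <= size s)%N ->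
    (forall j, (j < n)%N -> nth false s j = v j) -> W s -> in_cylinder v s.
Proof.
move=> noinc; apply: contrapT => nn.
have /choice[f fP] : forall n, exists s, [/\ (n <= size s)%N,
    forall j, (j < n)%N -> nth false s j = v j, W s & ~ in_cylinder v s].
  move=> n; apply: contrapT => ns; apply: nn; exists n => s le E Ws.
  by apply: contrapT => nc; apply: ns; exists s.
(* The word [f (N k)] leaves v before position [N k.+1], up to which all later selected words still
   follow v. *)
pose N := fix N k := if k is k'.+1 then size (f (N k')) else 0%N.
have NS k : (N k <= N k.+1)%N by have [] := fP (N k).
have Nmono : {homo N : i j / (i <= j)%N} by exact: (homo_leq leqnn leq_trans NS).
apply: (noinc [ffun i : 'I_D.+1 => f (N i)]) => [i j ij|i]; rewrite !ffunE.
  have [_ _ _ /existsNP[m /not_implyP[ms mv]]] := fP (N i).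
  have mN : (m < N j)%N by exact: leq_trans ms (Nmono i.+1 j ij).
  have [szj Ej _ _] := fP (N j).
  exists m; split=> //; first exact: leq_trans szj.
  by rewrite Ej// => E; apply: mv.
by have [] := fP (N i).
Qed.

Section LusinNovikov.
Context (d : measure_display) (J : measurableType d) (R : realType).
Variable phi : J -> R.
Hypotheses (mphi : measurable_fun setT phi) (phi_inj : injective phi)
  (mphi_img : forall A, measurable A -> measurable (phi @` A)).

Let code x : nat -> bool := cut_code (phi x).

Let code_inj : injective code.
Proof. by move=> x y /cut_code_inj/phi_inj. Qed.

Let code_img A : code @` A = cut_code @` (phi @` A).
Proof. by rewrite -image_comp. Qed.

Let bor_code A : measurable A -> bor (code @` A).
Proof. by move=> mA; rewrite code_img; apply: bor_cut_code; exact: mphi_img. Qed.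

Let mcode n Q : measurable [set x | Q (code x n)].
Proof.
apply: measurable_bool_pred; rewrite /code /cut_code.
rewrite [X in measurable X](_ : _ = setT `&` phi @^-1` `]-oo, ratr (rat_of_nat n)[).
  by apply: mphi => //; exact: measurable_itv.
by apply/seteqP; split=> x; rewrite /= in_itv/=; [split|case].
Qed.

Let code2 (p : J * J) n := (code p.1 n, code p.2 n).

Let bor_code2 (F : set (J * J)) : measurable F -> bor (code2 @` F).
Proof.
have rect A B : measurable A -> measurable B -> bor (code2 @` (A `*` B)).
  move=> mA mB; have := borI (bor_comp_letter fst (bor_code mA))
                             (bor_comp_letter snd (bor_code mB)).
  congr bor; apply/seteqP; split=> [u [[x Ax xu] [y By yu]]|_ [[x y] [Ax By] <-]].
    exists (x, y) => //; apply/funext => n; rewrite /code2/=.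
    by rewrite xu yu /=; case: (u n).
  by split; [exists x|exists y].
have inj2 : injective code2.
  move=> [x y] [x' y'] E; congr pair; apply: code_inj; apply/funext => n.
    by have := congr1 (fun u => (u n).1) E.
  by have := congr1 (fun u => (u n).2) E.
have brange : bor (range code2).
  by rewrite -setXTT; apply: rect.
rewrite measurable_prod_measurableType => mF.
apply: (smallest_sub (sigma_algebra_bor_image inj2 brange) _ mF).
by move=> _ [A mA [B mB <-]]; exact: rect.
Qed.

(** For a prefix s, [Q s] projects onto the codes of the x having a neighbour whose code starts with
    s. For D+1 pairwise incompatible prefixes these sets have no common point, as it would have D+1
    distinct neighbours; Novikov separation encloses them in Borel sets still without common point.
    So the words s with [code x] in the Borel set [W s] include all prefixes of codes of neighbours
    of x but no D+1 pairwise incompatible words, and [isolated_branch] recovers each neighbour from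
    a finite prefix. *)
Lemma lusin_novikov (F : set (J * J)) (D : nat) : measurable F ->
  (forall x, finite_set (nbrE F x) /\ (degE F x <= D)%N) ->
  exists h : nat -> J -> J, (forall n, measurable_fun setT (h n)) /\
    forall x y, F (x, y) -> exists n, h n x = y.
Proof.
move=> mF degF.
have [P [cP PF]] := bor_analytic (bor_code2 mF).
(* The sequence t carries the code of the neighbour in its first components and the witness that F
   is analytic in its second ones. *)
pose Q (s : seq bool) (u : nat -> bool) (t : nat -> bool * nat) :=
  P (fun n => (u n, (t n).1)) (snd \o t) /\ in_cylinder (fst \o t) s.
have closedQ s : closedP (Q s).
  move=> u t cQ; split.
    apply: cP => n; have [u' [t' [[Pu't' _] E]]] := cQ n.
    exists (fun n => (u' n, (t' n).1)), (snd \o t'); split=> // k kn.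
    by have [-> /= ->] := E k kn.
  move=> j js; have [u' [t' [[_ /(_ j js) /= <-] /(_ j js)[_ ->]]]] := cQ (size s).
  by [].
have QF s u : (exists t, Q s u t) ->
    exists x y, [/\ F (x, y), u = code x & in_cylinder (code y) s].
  case=> t [Pt ct]; have /PF[[x y] Fxy E] : exists s, P (fun n => (u n, (t n).1)) s.
    by exists (snd \o t).
  exists x, y; split=> //; first by apply/funext => n; have := congr1 (fun w => (w n).1) E.
  by move=> j js; have /= -> := congr1 (fun w => (w j).2) E; exact: ct.
have FQ s x y : F (x, y) -> in_cylinder (code y) s -> exists t, Q s (code x) t.
  move=> Fxy cy; have /PF[t Pt] : (code2 @` F) (code2 (x, y)) by exists (x, y).
  by exists (fun n => (code y n, t n)).
pose inc (t : {ffun 'I_D.+1 -> seq bool}) :=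
  forall i j : 'I_D.+1, (i < j)%N -> incompatible (t i) (t j).
have /choice[B BP] : forall t : {ffun 'I_D.+1 -> seq bool},
    exists B : 'I_D.+1 -> set (nat -> bool), [/\ forall i, bor (B i),
      forall i u, (exists s, Q (t i) u s) -> B i u & inc t -> forall u, ~ forall i, B i u].
  move=> t; have [inct|ninc] := pselect (inc t); last first.
    by exists (fun=> [set _ | True]); split=> // i; exact: bor_const.
  have [|B [bB QB dB]] := novikov_separation (fun i => closedQ (t i)); last first.
    by exists B; split=> // i u [s]; exact: QB.
  move=> u uQ; have /choice[xy xyP] := fun i => QF _ _ (uQ i).
  have /choice[y yP] := xyP.
  have [x0 [y0 [_ ux0 _]]] := QF _ _ (uQ ord0).
  have Fy i : F (x0, y i).
    have [Fxy uE _] := yP i; suff -> : x0 = xy i by [].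
    by apply: code_inj; rewrite -ux0.
  have y_inj : injective y.
    have lem (i j : 'I_D.+1) : (i < j)%N -> y i <> y j.
      move=> /inct[m [mi mj mij]] E; apply: mij.
      have [_ _ <-//] := yP i; have [_ _ <-//] := yP j.
      by rewrite E.
    move=> i j E; apply/val_inj; case: (ltgtP i j) => [ij|ij|->//].
      by have := lem _ _ ij.
    by have := lem _ _ ij => /(_ (esym E)).
  have [finF] := degF x0; rewrite leqNgt => /negP; apply.
  have -> : D.+1 = #|` [fset y i | i in 'I_D.+1]%fset|.
    by rewrite card_imfset//= -cardE card_ord.
  apply: fsubset_leq_card; apply/fsubsetP => z /imfsetP[i _ ->].
  by rewrite in_fset_set// inE; exact: Fy.
(* Intersecting over all families and positions where s occurs gives one Borel set per word that
   serves every family. *)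
pose W s : set (nat -> bool) := [set u | forall ti : ({ffun 'I_D.+1 -> seq bool} * 'I_D.+1)%type,
  ti.1 ti.2 = s -> B ti.1 ti.2 u].
have bW s : bor (W s).
  apply: bor_all => -[t i] /=; have [<-|ne] := eqVneq (t i) s.
    have [/(_ i) bB _ _] := BP t; move: bB; congr bor.
    by apply/seteqP; split=> u //= /(_ erefl).
  have := @bor_const bool True; congr bor.
  by apply/seteqP; split=> u //= _ E; rewrite E eqxx in ne.
have W1 x y s : F (x, y) -> in_cylinder (code y) s -> W s (code x).
  move=> Fxy cys [t i] /= ts; have [_ + _] := BP t; apply.
  by rewrite ts; exact: FQ cys.
have W2 t u : inc t -> ~ forall i, W (t i) u.
  move=> inct uW; have [_ _ /(_ inct u)] := BP t; apply => i.
  exact: (uW i (t, i)).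
(* When [s0] isolates a neighbour y, every word of W extending [s0] is a prefix of [code y], so
   these bits spell [code y]. *)
pose H s0 x j : bool := `[< exists s : seq bool, [/\ (size s0 <= size s)%N,
  forall i, (i < size s0)%N -> nth false s i = nth false s0 i, (j < size s)%N,
  nth false s j & W s (code x)] >].
have mH s0 j Q' : measurable [set x | Q' (H s0 x j)].
  apply: measurable_bool_pred.
  rewrite [X in measurable X](_ : _ = [set x | exists s : seq bool,
      [set _ | [/\ (size s0 <= size s)%N,
       forall i, (i < size s0)%N -> nth false s i = nth false s0 i, (j < size s)%N
       & nth false s j]] x /\ [set x | W s (code x)] x]).
    apply: measurable_exists => s; apply: measurableI; first exact: measurable_prop.
    exact: bor_preimage.
  apply/seteqP; split=> x /=; rewrite /H.
    by move=> /asboolP[s []]; exists s.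
  by move=> [s [[]]] *; apply/asboolP; exists s.
(* The default x keeps the map total and Borel where [H s0 x] is not a code. *)
pose theta s0 x := xget x [set y | code y = H s0 x].
have mtheta s0 : measurable_fun setT (theta s0).
  move=> _ A mA; rewrite setTI.
  pose dom := [set x | range code (H s0 x)].
  have mdom : measurable dom by apply: bor_preimage => //; exact: bor_code.
  rewrite [X in measurable X](_ : _ = [set x | (code @` A) (H s0 x)] `|`
      (A `&` ~` dom)).
    apply: measurableU; last by apply: measurableI => //; exact: measurableC.
    by apply: bor_preimage => //; exact: bor_code.
  apply/seteqP; split=> x; rewrite /theta /=.
    case: xgetP => [y _ /= yE Ay|noy Ax]; first by left; exists y.
    by right; split=> // -[y _ /= yE]; exact: (noy y).
  case=> [[y Ay yE]|[Ax ndom]]; case: xgetP.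
  - by move=> z _ /= zE; rewrite (_ : z = y)//; apply: code_inj; rewrite zE.
  - by move=> /(_ y)[].
  - by move=> z _ /= zE; case: ndom; exists z.
  - by [].
exists (fun n => if unpickle n is Some s then theta s else id); split.
  by move=> n; case: unpickle.
move=> x y Fxy.
have [n nP] := @isolated_branch D [set s | W s (code x)] (code y)
  (fun t inct => @W2 t (code x) inct).
exists (pickle (mkseq (code y) n)); rewrite pickleK /theta.
suff HE : H (mkseq (code y) n) x = code y.
  rewrite HE; case: xgetP => [z _ /code_inj//|/(_ y)].
  by case.
apply/funext => j; rewrite /H size_mkseq; apply/asboolP/idP => [[s [ns E js sj Ws]]|yj].
  rewrite (nP s)// => i ni.
  by rewrite E// nth_mkseq.
(* Long enough both to extend the isolating prefix and to contain position j. *)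
exists (mkseq (code y) (maxn n j.+1)); rewrite size_mkseq; split.
- exact: leq_maxl.
- by move=> i ni; rewrite !nth_mkseq// leq_max ni.
- exact: leq_maxr.
- by rewrite nth_mkseq// leq_maxr.
- by apply: (W1 x y) => // i; rewrite size_mkseq => ?; rewrite nth_mkseq.
Qed.

End LusinNovikov.

(** * Sums over countable Borel sections *)

Section CountableSections.
Context d (J : measurableType d) (R : realType) (phi : J -> R).
Hypotheses (mphi : measurable_fun setT phi) (phi_inj : injective phi).

Lemma measurable_eq_points dX (X : measurableType dX) (a b : X -> J) :
  measurable_fun setT a -> measurable_fun setT b -> measurable [set x | a x = b x].
Proof.
move=> ma mb; pose e x := phi (a x) == phi (b x).
have me : measurable_fun setT e.
  by apply: measurable_fun_eqr; exact: measurableT_comp.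
rewrite [X in measurable X](_ : _ = setT `&` e @^-1` [set true]); first exact: me.
by apply/seteqP; split=> x; rewrite /= /e; [move=> ->; rewrite eqxx|case=> _ /eqP/phi_inj].
Qed.

Section Selectors.
Context dX (X : measurableType dX) (V : nat -> set X) (theta : nat -> X -> J).
Hypotheses (mV : forall n, measurable (V n))
  (mtheta : forall n, measurable_fun setT (theta n)).

(** Keeps only the least index producing a given point, so that an enumeration with repetitions is
    summed without repetition. *)
Definition first_hit n : set X :=
  [set x | V n x /\ forall m : 'I_n, ~ (V m x /\ theta m x = theta n x)].

Lemma measurable_first_hit n : measurable (first_hit n).
Proof.
apply: measurableI => //; apply: measurable_forall => m; apply: measurableC.
by apply: measurableI => //; exact: measurable_eq_points.
Qed.

Variable K : X -> set J.
Hypothesis K_enum : forall x y, K x y <-> exists n, V n x /\ theta n x = y.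

Lemma esum_sections (f : X * J -> \bar R) x : (forall p, 0 <= f p)%E ->
  (\esum_(y in K x) f (x, y) =
   \sum_(n <oo) (f (x, theta n x) * (\1_(first_hit n) x)%:E))%E.
Proof.
move=> f0; rewrite nneseries_esumT; last first.
  by move=> n; apply: mule_ge0 => //; rewrite lee_fin.
rewrite (reindex_esum [set n | first_hit n x] _ (theta ^~ x)); last first.
  split=> [n [Vn _]|n m|y /K_enum Ky]; first by apply/K_enum; exists n.
    rewrite !inE => -[Vn hn] [Vm hm] E; case: (ltgtP n m) => // nm.
      by case: (hm (Ordinal nm)).
    by case: (hn (Ordinal nm)).
  have ex : exists n, `[< V n x /\ theta n x = y >].
    by have [n nE] := Ky; exists n; apply/asboolP.
  case: (ex_minnP ex) => n /asboolP[Vn nE] nmin; exists n => //=; split=> // m [Vm E].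
  have /nmin : `[< V m x /\ theta m x = y >] by apply/asboolP; rewrite E.
  by rewrite leqNgt ltn_ord.
rewrite esum_mkcond; apply: eq_esum => n _; rewrite indicE.
have -> : (n \in [set n | first_hit n x]) = (x \in first_hit n).
  by apply/idP/idP; rewrite !inE.
by case: (x \in first_hit n); rewrite ?mule1 ?mule0.
Qed.

Lemma measurable_section_term (f : X * J -> \bar R) n :
  measurable_fun setT f ->
  measurable_fun setT (fun x => f (x, theta n x) * (\1_(first_hit n) x)%:E)%E.
Proof.
move=> mf; apply: emeasurable_funM; last first.
  by apply/measurable_EFinP; apply: measurable_indic; exact: measurable_first_hit.
exact: (measurableT_comp mf (measurable_fun_pair (@measurable_id _ X setT) (mtheta n))).
Qed.

Lemma measurable_esum_sections (f : X * J -> \bar R) :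
  (forall p, 0 <= f p)%E -> measurable_fun setT f ->
  measurable_fun setT (fun x => \esum_(y in K x) f (x, y))%E.
Proof.
move=> f0 mf.
rewrite (_ : (fun _ => _) = (fun x => \sum_(n <oo | n \in predT)
    (f (x, theta n x) * (\1_(first_hit n) x)%:E)))%E; last first.
  by apply/funext => x; rewrite esum_sections.
apply: ge0_emeasurable_sum => n.
  by move=> x _ _; apply: mule_ge0 => //; rewrite lee_fin.
by move=> _; exact: measurable_section_term.
Qed.

End Selectors.

End CountableSections.

(** * Reciprocal cardinality as a series over size thresholds *)

Section InverseCardinal.
Context {R : realType}.

Definition card_sum (T : choiceType) (S : set T) : \bar R := (\esum_(y in S) 1)%E.

Lemma card_sum_fin (T : choiceType) (S : set T) : finite_set S ->
  card_sum S = (#|` fset_set S|%:R)%:E.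
Proof.
move=> fS; rewrite /card_sum esum_fset//.
rewrite fsbig_finite//= sumEFin; congr EFin.
by rewrite big_const_seq count_predT iter_addr addr0.
Qed.

Lemma card_sum_inf (T : choiceType) (S : set T) : infinite_set S ->
  card_sum S = +oo%E.
Proof.
move=> iS; apply/eqyP => r r0; apply: esum_ge.
have [B BS cB] := infinite_set_fset `|Num.ceil r|%N iS.
exists [set` B]; first by split=> //; exact: finite_fset.
rewrite fsbig_finite//= set_fsetK sumEFin lee_fin.
rewrite big_const_seq count_predT iter_addr addr0.
apply: le_trans (Num.Theory.ceil_ge r) _.
rewrite -[in leLHS](gez0_abs (_ : 0 <= Num.ceil r)); last by rewrite ceil_ge0 (lt_le_trans _ (ltW r0))// ltrN10.
by rewrite ler_nat.
Qed.

(** These weights telescope: those with n >= N - 1 add up to 1/N. An infinite set lies under no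
    threshold, which produces 1/oo = 0. *)
Definition inv_gap n : R := (n.+1%:R)^-1 - (n.+2%:R)^-1.

Lemma inv_gap_ge0 n : 0 <= inv_gap n.
Proof. by rewrite subr_ge0 lef_pV2 ?posrE ?ltr0n// ler_nat. Qed.

Lemma sum_inv_gap k :
  (\sum_(n <oo) (inv_gap n * (k <= n)%:R)%:E = ((k.+1%:R)^-1 : R)%:E)%E.
Proof.
have part m : (\sum_(0 <= n < k + m) (inv_gap n * (k <= n)%:R)%:E =
    ((k.+1%:R)^-1 - ((k + m).+1%:R)^-1 : R)%:E)%E.
  elim: m => [|m ih].
    rewrite addn0 subrr big_nat_cond big1// => n /andP[/andP[_ nk] _].
    by rewrite leqNgt nk mulr0.
  by rewrite addnS big_nat_recr//= ih leq_addr mulr1 -EFinD /inv_gap addrA subrK.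
apply/cvg_lim => //; rewrite -(cvg_shiftn k)/=.
rewrite (_ : (fun _ => _) = fun m => ((k.+1%:R)^-1 - ((k + m).+1%:R)^-1 : R)%:E); last first.
  by apply/funext => m; rewrite addnC part.
apply: cvg_EFin; first by near=> n.
rewrite -[X in _ --> X]subr0; apply: cvgB; first exact: cvg_cst.
rewrite (_ : (fun _ => _) = fun n => (harmonic : R^nat) (n + k)%N).
  by rewrite (cvg_shiftn k (harmonic : R^nat)); exact: cvg_harmonic.
by apply/funext => n; rewrite /harmonic/= addnC.
Unshelve. all: by end_near. Qed.

(** [inv_comp R F x] is convertible to [inv_card (comp F x)]; the general form also applies to the
    union of two components. *)
Definition inv_card (T : choiceType) (S : set T) : R :=
  if `[< finite_set S >] then (#|` fset_set S|%:R)^-1 else 0.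

(** For the empty set the left side would be 0^-1 = 0 and the series 1. For the others this reduces
    measurability to comparisons of sizes. *)
Lemma inv_cardE (T : choiceType) (S : set T) : S !=set0 ->
  ((inv_card S)%:E = \sum_(n <oo) (inv_gap n * ((card_sum S <= n.+1%:R%:E)%E)%:R)%:E)%E.
Proof.
move=> [y Sy]; rewrite /inv_card; case: asboolP => fS.
  have : (0 < #|` fset_set S|)%N.
    by rewrite cardfs_gt0; apply/fset0Pn; exists y; rewrite in_fset_set ?inE.
  rewrite card_sum_fin//; case: #|` _| => // k _.
  by rewrite -sum_inv_gap; apply: eq_eseriesr => n _; rewrite lee_fin ler_nat.
rewrite card_sum_inf// eseries0// => n _ _.
by rewrite leye_eq mulr0.
Qed.

End InverseCardinal.

(** * Components as countable unions of Borel walks *)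

Section Walks.
Context d (J : measurableType d) (R : realType) (phi : J -> R).
Hypotheses (mphi : measurable_fun setT phi) (phi_inj : injective phi).
Variables (E : set (J * J)) (h : nat -> J -> J).
Hypotheses (mE : measurable E) (E_sym : forall x y, E (x, y) -> E (y, x))
  (mh : forall n, measurable_fun setT (h n))
  (h_cover : forall x y, E (x, y) -> exists n, h n x = y).

(* The letter (n, m) stands for the partial injection x |-> h n x defined where
   h m inverts it, so that reversing a word inverts the walk. *)
Local Notation letter := (nat * nat)%type.

Definition word n : seq letter := odflt [::] (unpickle n).

Lemma word_surj w : exists n, word n = w.
Proof. by exists (pickle w); rewrite /word pickleK. Qed.

Fixpoint walk (w : seq letter) (x : J) : J :=
  if w is l :: w' then walk w' (h l.1 x) else x.

Fixpoint walk_in (B : set (J * J)) (w : seq letter) (x : J) : Prop :=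
  if w is l :: w' then
    [/\ B (x, h l.1 x), h l.2 (h l.1 x) = x & walk_in B w' (h l.1 x)]
  else True.

Definition inv_word (w : seq letter) : seq letter := rev [seq (l.2, l.1) | l <- w].

Lemma inv_word_cons l w : inv_word (l :: w) = rcons (inv_word w) (l.2, l.1).
Proof. by rewrite /inv_word/= rev_cons. Qed.

Lemma inv_wordK : involutive inv_word.
Proof.
move=> w; rewrite /inv_word map_rev revK -map_comp map_id_in// => -[] //.
Qed.

Lemma walk_rcons w l x : walk (rcons w l) x = h l.1 (walk w x).
Proof. by elim: w x => //= l' w ih x; rewrite ih. Qed.

Lemma walk_in_rcons B w l x : walk_in B (rcons w l) x <->
  [/\ walk_in B w x, B (walk w x, h l.1 (walk w x)) & h l.2 (h l.1 (walk w x)) = walk w x].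
Proof.
elim: w x => [|l' w ih] x /=; first by split=> [[]|[]].
split=> [[? ? /ih[]]|[[? ? ?] ? ?]]; first by split.
by split=> //; apply/ih.
Qed.

Lemma walk_inv w x : walk_in E w x ->
  walk_in E (inv_word w) (walk w x) /\ walk (inv_word w) (walk w x) = x.
Proof.
elim: w x => [//|l w ih] x /= [Ex hx /ih[ok wk]].
rewrite inv_word_cons walk_rcons wk/=; split=> //.
by apply/walk_in_rcons; rewrite wk /= hx; split=> //; exact: E_sym.
Qed.

(** Makes reachability a countable disjunction of Borel conditions. The returning index of each
    letter exists because E is symmetric. *)
Lemma compP B x y : B `<=` E -> comp B x y <-> exists w, walk_in B w x /\ walk w x = y.
Proof.
move=> BE; split=> [xy|[w]].
  have {xy} : clos_refl_trans_1n J (fun a b => B (a, b)) x y by exact: clos_rt_rt1n xy.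
  elim=> {x y} [x|x y z Bxy _ [w [ok wk]]]; first by exists [::].
  have [n nE] := h_cover (BE _ Bxy); have [m mE'] := h_cover (E_sym (BE _ Bxy)).
  by exists ((n, m) :: w) => /=; rewrite nE; split.
elim: w x => [x [_ <-]|l w ih x /= [[Bx _ ok] wk]]; first exact: rt_refl.
by apply: rt_trans (rt_step _ _ _ _ Bx) _; exact: ih.
Qed.

Lemma measurable_walk w : measurable_fun setT (walk w).
Proof. by elim: w => [|l w ih] /=; [exact: measurable_id|exact: measurableT_comp]. Qed.

Section MeasurableFamilies.
Context dX (X : measurableType dX) (z : X -> J) (B : X -> set (J * J)).
Hypotheses (mz : measurable_fun setT z) (BE : forall x, B x `<=` E)
  (mB : measurable [set q : X * (J * J) | B q.1 q.2]).

(** The edge set depends on the parameter as well as the starting point, because the components of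
    interest are those of the edges above p with p varying. *)
Lemma measurable_walk_in w : measurable [set x | walk_in (B x) w (z x)].
Proof.
elim: w z mz => [|l w ih] z' mz' /=; first exact: measurable_prop.
have mhz : measurable_fun setT (fun x => h l.1 (z' x)) by exact: measurableT_comp.
rewrite [X in measurable X](_ : _ = [set x | B x (z' x, h l.1 (z' x))] `&`
   ([set x | h l.2 (h l.1 (z' x)) = z' x] `&` [set x | walk_in (B x) w (h l.1 (z' x))])).
  apply: measurableI; last apply: measurableI.
  - have := measurable_fun_pair (@measurable_id _ X setT) (measurable_fun_pair mz' mhz).
    by move=> /(_ measurableT _ mB); rewrite setTI.
  - by apply: (measurable_eq_points mphi phi_inj) => //; exact: measurableT_comp.
  - exact: ih.
by apply/seteqP; split=> x /= [] // ? [].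
Qed.

Let theta (n : nat) (x : X) : J := walk (word n) (z x).

Let mtheta n : measurable_fun setT (theta n).
Proof. by apply: measurableT_comp => //; exact: measurable_walk. Qed.

Let comp_enum x y : comp (B x) (z x) y <->
  exists n, walk_in (B x) (word n) (z x) /\ theta n x = y.
Proof.
rewrite (compP _ _ (@BE x)); split=> [[w ?]|[n ?]]; last by exists (word n).
by have [n nw] := word_surj w; exists n; rewrite /theta nw.
Qed.

Lemma measurable_comp : measurable [set q : X * J | comp (B q.1) (z q.1) q.2].
Proof.
rewrite [X in measurable X](_ : _ = [set q : X * J | exists w,
    [set q : X * J | walk_in (B q.1) w (z q.1)] q /\
    [set q : X * J | walk w (z q.1) = q.2] q]).
  apply: measurable_exists => w; apply: measurableI.
    have := measurable_walk_in w => m.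
    by have := @measurable_fst _ _ X J; move=> /(_ measurableT _ m); rewrite setTI.
  apply: (measurable_eq_points mphi phi_inj) => //.
  apply: measurableT_comp; first exact: measurable_walk.
  exact: measurableT_comp.
by apply/seteqP; split=> -[x y] /=; rewrite compP.
Qed.

Lemma measurable_esum_comp (f : X * J -> \bar R) :
  (forall p, 0 <= f p)%E -> measurable_fun setT f ->
  measurable_fun setT (fun x => \esum_(y in comp (B x) (z x)) f (x, y))%E.
Proof.
move=> f0 mf.
exact: (measurable_esum_sections mphi phi_inj
  (fun n => measurable_walk_in (word n)) mtheta comp_enum f0 mf).
Qed.

Lemma measurable_card_comp :
  measurable_fun setT (fun x => card_sum (comp (B x) (z x)) : \bar R).
Proof.
by apply: (@measurable_esum_comp (fun=> 1%E)) => // p; rewrite lee_fin.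
Qed.

Lemma measurable_inv_comp :
  measurable_fun setT (fun x => inv_comp R (B x) (z x)).
Proof.
apply/measurable_EFinP.
rewrite [X in measurable_fun _ X](_ : _ = (fun x => \sum_(n <oo | n \in predT)
  ((inv_gap n : R) * ((card_sum (comp (B x) (z x)) <= n.+1%:R%:E :> \bar R)%E)%:R)%:E)%E);
  last first.
  apply/funext => x; rewrite /= -inv_cardE//.
  by exists (z x); exact: rt_refl.
apply: ge0_emeasurable_sum => n.
  by move=> x _ _; rewrite lee_fin mulr_ge0// inv_gap_ge0.
move=> _; apply/measurable_EFinP; apply: measurable_funM; first exact: measurable_cst.
rewrite (_ : (fun _ => _) = \1_[set x | (card_sum (comp (B x) (z x)) <= (n.+1%:R%:E : \bar R))%E]).
  apply: measurable_indic; rewrite -[X in measurable X]setTI.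
  apply: emeasurable_fun_infty_c => //; exact: measurable_card_comp.
by apply/funext => x; rewrite indicE mem_setE.
Qed.

End MeasurableFamilies.
End Walks.

(** * Mass transport *)

Lemma esum_single (R : realType) (T : choiceType) (S : set T) (a : T -> \bar R) y0 :
  (0 <= a y0)%E -> (forall y, S y -> y <> y0 -> a y = 0%E) ->
  (\esum_(y in S) a y = if y0 \in S then a y0 else 0)%E.
Proof.
move=> a0 aS.
transitivity (\esum_(y in [set y0]) (if y0 \in S then a y0 else 0))%E; last first.
  by rewrite esum_set1//; case: ifP.
rewrite [RHS]esum_mkcond esum_mkcond; apply: eq_esum => y _.
have [->|/eqP yy0] := eqVneq y y0; first by rewrite [y0 \in [set y0]]mem_set.
rewrite [y \in [set y0]]memNset//; case: ifPn => // /[!inE] Sy; exact: aS.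
Qed.

(** A graphing packed with the Borel injection [phi] into the reals and the maps [h] obtained from
    [lusin_novikov]. *)
Record enumerated_graphing d (J : measurableType d) (R : realType)
    (mu : probability J R) (phi : J -> R) (adj : J -> J -> Prop)
    (h : nat -> J -> J) (D : nat) : Prop := EnumeratedGraphing {
  eg_mphi : measurable_fun setT phi;
  eg_phi_inj : injective phi;
  eg_mE : measurable (Edir adj);
  eg_sym : forall x y, adj x y -> adj y x;
  eg_irr : forall x, ~ adj x x;
  eg_mh : forall n, measurable_fun setT (h n);
  eg_cover : forall x y, Edir adj (x, y) -> exists n, h n x = y;
  eg_deg : forall x, finite_set (nbrE (Edir adj) x) /\ (degE (Edir adj) x <= D)%N;
  eg_balanced : forall A B, measurable A -> measurable B ->
    (\int[mu]_(x in A) ((deg adj B x)%:R : R)%:E =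
     \int[mu]_(x in B) ((deg adj A x)%:R : R)%:E)%E }.

Section MassTransport.
Context d (J : measurableType d) (R : realType) (mu : probability J R).
Context (phi : J -> R) (adj : J -> J -> Prop) (h : nat -> J -> J) (D : nat).
Local Notation E := (Edir adj).
Hypothesis graphing : enumerated_graphing mu phi adj h D.

Let mphi := eg_mphi graphing.
Let phi_inj := eg_phi_inj graphing.
Let mE := eg_mE graphing.
Let adj_sym := eg_sym graphing.
Let adj_irr := eg_irr graphing.
Let mh := eg_mh graphing.
Let h_cover := eg_cover graphing.
Let degD := eg_deg graphing.
Let balanced := eg_balanced graphing.

Local Open Scope ereal_scope.

Definition nbr_sum (f : J * J -> \bar R) (x : J) := \esum_(y in nbrE E x) f (x, y).

Let V n : set J := [set x | E (x, h n x)].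

Let mV n : measurable (V n).
Proof.
have := measurable_fun_pair (@measurable_id _ J setT) (mh n).
by move=> /(_ measurableT _ mE); rewrite setTI.
Qed.

Let nbr_enum x y : nbrE E x y <-> exists n, V n x /\ h n x = y.
Proof.
split=> [Exy|[n [Vn <-//]]].
by have [n nE] := h_cover Exy; exists n; rewrite /V /= nE.
Qed.

Local Notation hit := (first_hit V h).

Let mhit n : measurable (hit n).
Proof. exact: (measurable_first_hit mphi phi_inj mV mh). Qed.

Lemma nbr_sumE f x : (forall p, 0 <= f p) ->
  nbr_sum f x = \sum_(n <oo) (f (x, h n x) * (\1_(hit n) x)%:E).
Proof. by move=> f0; rewrite /nbr_sum (esum_sections nbr_enum). Qed.

Lemma measurable_nbr_sum f : (forall p, 0 <= f p) -> measurable_fun setT f ->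
  measurable_fun setT (nbr_sum f).
Proof. exact: (measurable_esum_sections mphi phi_inj mV mh nbr_enum). Qed.

Lemma nbr_sum_ge0 f x : (forall p, 0 <= f p) -> 0 <= nbr_sum f x.
Proof. by move=> f0; apply: esum_ge0. Qed.

(* The points off [hit n] are sent to the diagonal, which [E] avoids. *)
Let edge_map n (x : J) : J * J := if x \in hit n then (x, h n x) else (x, x).

Let medge_map n : measurable_fun setT (edge_map n).
Proof.
apply: measurable_fun_ifT.
- apply: (measurable_fun_bool true); rewrite setTI preimage_mem_true.
  exact: mhit.
- by apply: measurable_fun_pair => //; exact: measurable_id.
- by apply: measurable_fun_pair => //; exact: measurable_id.
Qed.

Let edge_map_preim n : edge_map n @^-1` E = hit n.
Proof.
apply/seteqP; split=> x; rewrite /= /edge_map.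
  by case: ifPn => [/[!inE]//|_ /= /adj_irr].
by move=> hx; rewrite mem_set//; case: hx.
Qed.

Let edge_mfun n : {mfun J >-> (J * J)%type} :=
  HB.pack (edge_map n) (isMeasurableFun.Build _ _ _ _ _ (medge_map n)).

Let edge_map_measure n : {measure set (J * J) -> \bar R} :=
  distribution mu (edge_mfun n).

(** Restricted to E this is the measure of directed edges, twice eta on symmetric edge sets; the
    diagonal carries the spurious mass of the points off the hits. *)
Let nu : {measure set (J * J) -> \bar R} := mseries edge_map_measure 0.

Let integral_nu f : (forall p, 0 <= f p) -> measurable_fun setT f ->
  \int[nu]_(p in E) f p = \int[mu]_x nbr_sum f x.
Proof.
move=> f0 mf; rewrite ge0_integral_measure_series//; last exact: measurable_funTS.
under [in RHS]eq_integral do rewrite nbr_sumE//.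
rewrite integral_nneseries//; last 2 first.
- by move=> n; exact: (measurable_section_term mphi phi_inj mV mh).
- by move=> n x _; apply: mule_ge0 => //; rewrite lee_fin.
apply: eq_eseriesr => n _.
rewrite ge0_integral_pushforward//; last exact: measurable_funTS.
rewrite edge_map_preim integral_mkcond; apply: eq_integral => x _.
rewrite epatch_indic /= /edge_map indicE.
by case: (x \in hit n); rewrite ?mule0.
Qed.

Lemma nbr_sum_deg F x : F `<=` E ->
  nbr_sum (EFin \o \1_F) x = ((degE F x)%:R : R)%:E.
Proof.
move=> FE; have sub : nbrE F x `<=` nbrE E x by move=> y /FE.
rewrite /degE -card_sum_fin; last exact: sub_finite_set sub (degD x).1.
rewrite /card_sum -(setIidr sub) esum_mkcondr; apply: eq_esum => y _ /=.
rewrite indicE; have -> : ((x, y) \in F) = (y \in nbrE F x).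
  by apply/idP/idP; rewrite !inE.
by case: (y \in _).
Qed.

Let nuE A : measurable A -> nu (A `&` E) = \int[mu]_x nbr_sum (EFin \o \1_A) x.
Proof.
move=> mA; rewrite -integral_indic// integral_nu//.
by apply/measurable_EFinP; exact: measurable_indic.
Qed.

Lemma nbr_sum_measure : exists m : {measure set (J * J) -> \bar R},
  forall f, (forall p, 0 <= f p) -> measurable_fun setT f ->
  \int[m]_(p in E) f p = \int[mu]_x nbr_sum f x.
Proof. by exists nu => f; exact: integral_nu. Qed.

Let nu_rect A B : measurable A -> measurable B ->
  nu ((A `*` B) `&` E) = \int[mu]_(x in A) ((deg adj B x)%:R : R)%:E.
Proof.
move=> mA mB; rewrite nuE; last exact: measurableX.
rewrite [RHS]integral_mkcond; apply: eq_integral => x _.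
rewrite /patch -nbr_sum_deg; last by move=> p [].
case: ifPn => [/[!inE] Ax|/negP Ax].
  apply: eq_esum => y Exy /=; congr EFin; rewrite !indicE; congr ((nat_of_bool _)%:R).
  by apply/idP/idP; rewrite !inE => -[]// _ By; split.
rewrite /nbr_sum esum1// => y _ /=; rewrite indicE memNset// => -[/= xA _].
by apply: Ax; rewrite inE.
Qed.

Let swap_edge_mfun n : {mfun J >-> (J * J)%type} :=
  HB.pack (swap_pair \o edge_map n) (isMeasurableFun.Build _ _ _ _ _
    (measurableT_comp (@measurable_swap _ _ J J) (medge_map n))).

Let nu' : {measure set (J * J) -> \bar R} :=
  mseries (fun n => distribution mu (swap_edge_mfun n)) 0.

Let swapE : swap_pair @^-1` E = E.
Proof. by apply/seteqP; split=> -[x y] /= /adj_sym. Qed.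

(** The balance of degrees is this equality on rectangles, which form a generating class closed
    under intersection; it extends to all Borel sets because the degree bound makes [nu] finite on
    E. *)
Let nu_sym A : measurable A -> A `<=` E -> nu A = nu' A.
Proof.
move=> mA AE.
suff : mrestr nu mE A = mrestr nu' mE A by rewrite /mrestr (setIidl AE).
have mA' := mA; rewrite measurable_prod_measurableType in mA'.
pose G := [set A `*` B | A in @measurable _ J & B in @measurable _ J].
apply: (@g_sigma_algebra_measure_unique _ R _ G _ (fun=> setT) _ _
  (mrestr nu mE) (mrestr nu' mE)) => //.
- by move=> _ [X mX [Y mY <-]]; exact: measurableX.
- by move=> _; exists setT => //; exists setT => //; rewrite setXTT.
- by rewrite bigcup_const//; exists 0%N.
- move=> _ _ [X mX [Y mY <-]] [X' mX' [Y' mY' <-]].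
  exists (X `&` X'); first exact: measurableI.
  by exists (Y `&` Y'); [exact: measurableI|rewrite setXI].
- move=> _ [X mX [Y mY <-]]; rewrite /mrestr.
  change (nu ((X `*` Y) `&` E) = nu (swap_pair @^-1` ((X `*` Y) `&` E))).
  rewrite preimage_setI swapE.
  rewrite (_ : swap_pair @^-1` (X `*` Y) = Y `*` X); last first.
    by apply/seteqP; split=> -[x y] /= [].
  by rewrite !nu_rect//; exact: balanced.
- move=> _; change (nu (setT `&` E) < +oo); rewrite nuE//.
  apply: (@le_lt_trans _ _ (\int[mu]_x D%:R%:E)).
    apply: ge0_le_integral => //.
    + by move=> x _; apply: nbr_sum_ge0 => p; rewrite /= lee_fin.
    + apply: measurable_nbr_sum => [p|]; first by rewrite /= lee_fin.
      by apply/measurable_EFinP; exact: measurable_indic.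
    + move=> x _; rewrite (_ : nbr_sum _ _ = nbr_sum (EFin \o \1_E) x).
        by rewrite nbr_sum_deg// lee_fin ler_nat; exact: (degD x).2.
      by apply: eq_esum => y Exy /=; rewrite !indicE !mem_set.
  by rewrite integral_cst//= ?probability_setT ?mule1 ?ltry.
Qed.

(** Mass transport over one edge, from the invariance of [nu] on E under swapping. *)
Lemma edge_transport f : (forall p, 0 <= f p) -> measurable_fun setT f ->
  \int[mu]_x nbr_sum f x = \int[mu]_x nbr_sum (f \o swap_pair) x.
Proof.
move=> f0 mf.
have mfs := measurableT_comp mf (@measurable_swap _ _ J J).
have fs0 p : 0 <= (f \o swap_pair) p by exact: f0.
rewrite -(integral_nu f0 mf) -(integral_nu fs0 mfs).
transitivity (\int[nu']_(p in E) f p); first exact: eq_measure_integral.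
rewrite !ge0_integral_measure_series//; try exact: measurable_funTS.
apply: eq_eseriesr => n _; rewrite !ge0_integral_pushforward//;
  try exact: measurable_funTS.
by rewrite comp_preimage swapE.
Qed.

Let E_sym x y : E (x, y) -> E (y, x). Proof. exact: adj_sym. Qed.

Let okl n m : set J := [set x | E (x, h n x) /\ h m (h n x) = x].

(** Edge transport applied to u cut down to the graph of the partial injection (n, m): both
    neighbour sums then have at most one non-zero term. *)
Let letter_transport u n m : (forall p, 0 <= u p) -> measurable_fun setT u ->
  \int[mu]_x (u (x, h n x) * (\1_(okl n m) x)%:E) =
  \int[mu]_x (u (h m x, x) * (\1_(okl m n) x)%:E).
Proof.
move=> u0 mu'.
pose G := [set p : J * J | p.2 = h n p.1 /\ h m p.2 = p.1].
have mG : measurable G.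
  by apply: measurableI; apply: (measurable_eq_points mphi phi_inj) => //;
     exact: measurableT_comp.
pose f p := u p * (\1_G p)%:E.
have f0 p : 0 <= f p by apply: mule_ge0 => //; rewrite lee_fin.
have mf : measurable_fun setT f.
  by apply: emeasurable_funM => //; apply/measurable_EFinP; exact: measurable_indic.
have lhs x : nbr_sum f x = u (x, h n x) * (\1_(okl n m) x)%:E.
  rewrite /nbr_sum (esum_single (y0 := h n x))//; last first.
    by move=> y _ yn; rewrite /f indicE memNset ?mule0// => -[/= /yn].
  rewrite /f !indicE; case: ifPn => [/[!inE] Exy|/negP nE].
    congr (_ * (nat_of_bool _)%:R%:E); apply/idP/idP; rewrite !inE.
      by case.
    by case.
  by rewrite [x \in okl n m]memNset ?mule0// => -[Exy _]; apply: nE; rewrite inE.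
have rhs x : nbr_sum (f \o swap_pair) x = u (h m x, x) * (\1_(okl m n) x)%:E.
  rewrite /nbr_sum (esum_single (y0 := h m x)) ?f0//; last first.
    move=> y _ yn; change (f (y, x) = 0); rewrite /f indicE memNset ?mule0//.
    by move=> -[/= _ /esym/yn].
  change ((if h m x \in nbrE E x then f (h m x, x) else 0) =
    u (h m x, x) * (\1_(okl m n) x)%:E).
  rewrite /f !indicE; case: ifPn => [/[!inE] Exy|/negP nE].
    congr (_ * (nat_of_bool _)%:R%:E); apply/idP/idP; rewrite !inE.
      by case.
    by case.
  by rewrite [x \in okl m n]memNset ?mule0// => -[Exy _]; apply: nE; rewrite inE.
transitivity (\int[mu]_x nbr_sum f x); first by apply: eq_integral => x _; rewrite lhs.
by rewrite edge_transport//; apply: eq_integral => x _; rewrite rhs.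
Qed.

Let mwalk_in w : measurable [set x | walk_in h E w x].
Proof.
apply: (measurable_walk_in mphi phi_inj mh (B := fun=> E) (@measurable_id _ J setT)).
have := @measurable_snd _ _ J (J * J)%type.
by move=> /(_ measurableT _ mE); rewrite setTI.
Qed.

Let mindE dX (X : measurableType dX) (S : set X) : measurable S ->
  measurable_fun setT (fun x => (\1_S x)%:E : \bar R).
Proof. by move=> mS; apply/measurable_EFinP; exact: measurable_indic. Qed.

(** By induction: [u1] absorbs the rest of the walk so that the first letter can be reversed, then
    [u2] absorbs the reversed letter so that the induction hypothesis reverses the rest. *)
Let word_transport w u : (forall p, 0 <= u p) -> measurable_fun setT u ->
  \int[mu]_x (u (x, walk h w x) * (\1_[set x | walk_in h E w x] x)%:E) =
  \int[mu]_x (u (walk h (inv_word w) x, x) *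
                (\1_[set x | walk_in h E (inv_word w) x] x)%:E).
Proof.
elim: w u => [//|[n m] w ih] u u0 mu'.
pose u1 (p : J * J) := u (p.1, walk h w p.2) *
  (\1_[set x | walk_in h E w x] p.2)%:E.
have u10 p : 0 <= u1 p by apply: mule_ge0 => //; rewrite lee_fin.
have mwk := measurable_walk mh.
have mu1 : measurable_fun setT u1.
  apply: emeasurable_funM; last first.
    by apply: (measurableT_comp (mindE (mwalk_in w))).
  apply: (measurableT_comp mu'); apply: measurable_fun_pair => //.
  exact: measurableT_comp.
pose u2 (p : J * J) := u (h m p.1, p.2) * (\1_(okl m n) p.1)%:E.
have mokl : measurable (okl m n).
  apply: measurableI; first exact: (mV m).
  by apply: (measurable_eq_points mphi phi_inj) => //; exact: measurableT_comp.
have u20 p : 0 <= u2 p by apply: mule_ge0 => //; rewrite lee_fin.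
have mu2 : measurable_fun setT u2.
  apply: emeasurable_funM; last by apply: (measurableT_comp (mindE mokl)).
  apply: (measurableT_comp mu'); apply: measurable_fun_pair => //.
  exact: measurableT_comp.
transitivity (\int[mu]_x (u1 (x, h n x) * (\1_(okl n m) x)%:E)).
  apply: eq_integral => x _; rewrite /u1 /= -muleA -EFinM !indicE -natrM mulnb.
  congr (_ * (nat_of_bool _)%:R%:E); apply/idP/idP.
    by rewrite inE => -[? ? ?]; apply/andP; rewrite !inE.
  by rewrite inE => /andP[]; rewrite !inE => ? -[].
rewrite letter_transport//.
transitivity (\int[mu]_x (u2 (x, walk h w x) *
    (\1_[set x | walk_in h E w x] x)%:E)).
  by apply: eq_integral => x _; rewrite /u1 /u2 /= -!muleA; congr (_ * _); rewrite muleC.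
rewrite ih//; apply: eq_integral => x _.
rewrite inv_word_cons walk_rcons /u2 /= -muleA -EFinM !indicE -natrM mulnb.
congr (_ * (nat_of_bool _)%:R%:E); apply/idP/idP.
  by move=> /andP[]; rewrite !inE => -[? ?] ?; apply/walk_in_rcons.
by rewrite inE => /walk_in_rcons[? ? ?]; apply/andP; rewrite !inE.
Qed.

(** Both sides become series over words, compared term by term: the pairs joined for the first time
    by the k-th word are transported by that word. *)
Lemma mass_transport f : (forall p, 0 <= f p) -> measurable_fun setT f ->
  \int[mu]_x (\esum_(y in comp E x) f (x, y)) =
  \int[mu]_y (\esum_(x in comp E y) f (x, y)).
Proof.
move=> f0 mf.
pose V1 k := [set x | walk_in h E (word k) x].
(* Enumerating the right side by inverse words makes a pair appear first at the same index k from
   either end. *)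
pose V2 k := [set x | walk_in h E (inv_word (word k)) x].
pose t1 k := walk h (word k); pose t2 k := walk h (inv_word (word k)).
have e1 x y : comp E x y <-> exists k, V1 k x /\ t1 k x = y.
  rewrite (compP E_sym h_cover)//; split=> [[w ?]|[k ?]]; last by exists (word k).
  by have [k kw] := word_surj w; exists k; rewrite /V1 /t1 kw.
have e2 x y : comp E x y <-> exists k, V2 k x /\ t2 k x = y.
  rewrite (compP E_sym h_cover)//; split=> [[w ?]|[k ?]]; last first.
    by exists (inv_word (word k)).
  have [k kw] := word_surj (inv_word w); exists k.
  by rewrite /V2 /t2 kw inv_wordK.
have mt1 k : measurable_fun setT (t1 k) := measurable_walk mh _.
have mt2 k : measurable_fun setT (t2 k) := measurable_walk mh _.
have mV1 k : measurable (V1 k) := mwalk_in _.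
have mV2 k : measurable (V2 k) := mwalk_in _.
have mfs := measurableT_comp mf (@measurable_swap _ _ J J).
have fs0 p : 0 <= (f \o swap_pair) p by exact: f0.
under eq_integral do rewrite (esum_sections e1)//.
under [RHS]eq_integral do rewrite (esum_sections e2 _ fs0).
rewrite [LHS]integral_nneseries; [|exact: measurableT|
  move=> n; exact: (measurable_section_term mphi phi_inj mV1 mt1)|
  by move=> n x _; apply: mule_ge0 => //; rewrite lee_fin].
rewrite [RHS]integral_nneseries; [|exact: measurableT|
  move=> n; exact: (measurable_section_term mphi phi_inj mV2 mt2 _ mfs)|
  by move=> n x _; apply: mule_ge0; [exact: fs0|rewrite lee_fin]].
apply: eq_eseriesr => k _.
(* The part of [first_hit] that excludes earlier words is a condition on the pair alone, so it can
   be moved into the transported function. *)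
pose G := [set p : J * J | forall m : 'I_k, ~ (V1 m p.1 /\ t1 m p.1 = p.2)].
have mG : measurable G.
  apply: measurable_forall => m; apply: measurableC; apply: measurableI.
    have := @measurable_fst _ _ J J.
    by move=> /(_ measurableT _ (mV1 m)); rewrite setTI.
  by apply: (measurable_eq_points mphi phi_inj) => //; exact: measurableT_comp.
pose u p := f p * (\1_G p)%:E.
have u0 p : 0 <= u p by apply: mule_ge0 => //; rewrite lee_fin.
have mu' : measurable_fun setT u by apply: emeasurable_funM => //; exact: mindE.
transitivity (\int[mu]_x (u (x, t1 k x) * (\1_(V1 k) x)%:E)).
  apply: eq_integral => x _; rewrite /u /= -muleA -EFinM !indicE -natrM mulnb.
  congr (_ * (nat_of_bool _)%:R%:E); apply/idP/idP.
    by rewrite inE => -[? ?]; apply/andP; rewrite !inE.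
  by move=> /andP[]; rewrite !inE.
rewrite word_transport//; apply: eq_integral => x _.
rewrite /u /= -muleA -EFinM !indicE -natrM mulnb.
congr (_ * (nat_of_bool _)%:R%:E).
have inv_iff m y : V2 m x /\ t2 m x = y <-> V1 m y /\ t1 m y = x.
  rewrite /V1 /V2 /t1 /t2; split=> -[ok <-].
    by have := walk_inv E_sym ok; rewrite inv_wordK.
  exact: walk_inv.
apply/idP/idP.
  move=> /andP[]; rewrite !inE => Gx Vx; split=> // m /inv_iff[? ?].
  exact: (Gx m).
rewrite inE => -[Vx nV]; apply/andP; rewrite !inE; split=> // m /inv_iff[? ?].
exact: (nV m).
Qed.

End MassTransport.

(** * Components and the wired forest *)

Section Components.
Context d (J : measurableType d).
Implicit Types (B C : set (J * J)) (x y z w : J).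

Definition symmetric_edges B := forall x y, B (x, y) -> B (y, x).

Lemma comp_refl B x : comp B x x.
Proof. exact: rt_refl. Qed.

Lemma comp_edge B x y : B (x, y) -> comp B x y.
Proof. by move=> Bxy; exact: rt_step. Qed.

Lemma comp_trans B y x z : comp B x y -> comp B y z -> comp B x z.
Proof. exact: rt_trans. Qed.

Lemma comp_sym B x y : symmetric_edges B -> comp B x y -> comp B y x.
Proof.
move=> sB; elim=> {x y} [x y /sB/comp_edge//|x|x y z _ xy _ yz].
  exact: comp_refl.
exact: comp_trans yz xy.
Qed.

Lemma comp_subset B C x : B `<=` C -> comp B x `<=` comp C x.
Proof.
move=> BC y; elim=> {x y} [x y /BC/comp_edge//|x|x y z _ xy _ yz].
  exact: comp_refl.
exact: comp_trans xy yz.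
Qed.

Lemma comp_closed B (S : set J) x : S x ->
  (forall y z, S y -> B (y, z) -> S z) -> comp B x `<=` S.
Proof.
move=> Sx cl y xy; elim: xy Sx => {x y} [x y Bxy Sx|//|x y z _ ih1 _ ih2 /ih1/ih2//].
exact: cl Bxy.
Qed.

Lemma comp_eq B x y : symmetric_edges B -> comp B x y -> comp B x = comp B y.
Proof.
move=> sB xy; apply/seteqP; split=> z.
  by apply: comp_trans; exact: comp_sym.
exact: comp_trans.
Qed.

Definition add_edge B (p : J * J) : set (J * J) := B `|` [set p; swap_pair p].

Lemma comp_add_edge B x y z w : symmetric_edges B ->
  comp (add_edge B (x, y)) z w -> comp B z w \/
    ((comp B x z \/ comp B y z) /\ (comp B x w \/ comp B y w)).
Proof.
move=> sB; elim=> {z w} [z w|z|z v w _ ih1 _ ih2].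
- case=> [Bzw|]; first by left; exact: comp_edge.
  by case=> -[-> ->]; right; split; [left|right|right|left]; exact: comp_refl.
- by left; exact: comp_refl.
- case: ih1 => [zv|[xyz xyv]]; case: ih2 => [vw|[xyv' xyw]].
  + by left; exact: comp_trans zv vw.
  + right; split=> //; case: xyv' => [xv|yv]; [left|right];
      by apply: comp_trans (comp_sym sB zv).
  + by right; split=> //; case: xyv => [xv|yv]; [left|right]; exact: comp_trans vw.
  + by right.
Qed.

Section AddEdge.
Variables (B : set (J * J)) (x y : J).
Hypothesis sB : symmetric_edges B.
Local Notation B' := (add_edge B (x, y)).

Let sB' : symmetric_edges B'.
Proof.
by move=> z w [/sB|[[-> ->]|[-> ->]]]; [left|right; right|right; left].
Qed.

Let subB' z : comp B z `<=` comp B' z.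
Proof. by apply: comp_subset => p; left. Qed.

Lemma comp_add_redundant z : comp B x y -> comp B' z = comp B z.
Proof.
move=> xy; apply/seteqP; split=> w; last exact: subB'.
move=> /(comp_add_edge sB)[//|[xyz xyw]].
have xz : comp B x z by case: xyz => // yz; exact: comp_trans xy yz.
have xw : comp B x w by case: xyw => // yw; exact: comp_trans xy yw.
exact: comp_trans (comp_sym sB xz) xw.
Qed.

Lemma comp_add_out z : ~ comp B x z -> ~ comp B y z -> comp B' z = comp B z.
Proof.
move=> xz yz; apply/seteqP; split=> w; last exact: subB'.
by move=> /(comp_add_edge sB)[//|[[]]].
Qed.

Lemma comp_add_in z : comp B x z \/ comp B y z ->
  comp B' z = comp B x `|` comp B y.
Proof.
move=> xyz; apply/seteqP; split=> w.
  move=> /(comp_add_edge sB)[zw|[_ []]]; [|by left|by right].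
  by case: xyz => [xz|yz]; [left|right]; exact: comp_trans zw.
have xy : comp B' x y by apply: comp_edge; right; left.
have zx : comp B' z x.
  apply: comp_sym => //; case: xyz => [/subB'//|/subB' yz].
  exact: comp_trans xy yz.
case=> [/subB' xw|/subB' yw]; first exact: comp_trans zx xw.
exact: comp_trans zx (comp_trans xy yw).
Qed.

End AddEdge.

End Components.

Lemma strict_order_maximal (T : choiceType) (lt : T -> T -> Prop) (S : set T) :
  (forall p, ~ lt p p) -> (forall p q r, lt p q -> lt q r -> lt p r) ->
  finite_set S -> S !=set0 -> exists2 p, S p & forall q, S q -> ~ lt p q.
Proof.
move=> irr tr /finite_seqP[s ->] [x0 /= x0s].
elim: s x0 x0s => // x s ih _ _.
case: s ih => [_|y s ih].
  by exists x => [|q]; rewrite /= !inE// => /eqP->.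
have [p ps pmax] := ih y (mem_head _ _).
have [ltpx|nlt] := pselect (lt p x).
  exists x; first by rewrite /= mem_head.
  move=> q /=; rewrite inE => /orP[/eqP->//|qs ltxq].
  exact: pmax qs (tr _ _ _ ltpx ltxq).
exists p; first by rewrite /= inE ps orbT.
by move=> q /=; rewrite inE => /orP[/eqP->//|]; exact: pmax.
Qed.

(** * Drops of reciprocal cardinality, threshold by threshold *)

Section CardSum.
Context {R : realType}.
Implicit Types T : choiceType.

Lemma card_sum_leP T (S : set T) N :
  (card_sum S <= (N%:R%:E : \bar R))%E <-> finite_set S /\ (#|` fset_set S| <= N)%N.
Proof.
split=> [|[fS]]; last by rewrite card_sum_fin// lee_fin ler_nat.
have [fS|iS] := pselect (finite_set S).
  by rewrite card_sum_fin// lee_fin ler_nat.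
by rewrite card_sum_inf.
Qed.

Lemma le_card_sum T (S S' : set T) : S `<=` S' ->
  (card_sum S <= (card_sum S' : \bar R))%E.
Proof.
move=> SS'; rewrite /card_sum -(setIidr SS') esum_mkcondr; apply: le_esum => i _.
by case: ifP => // _; rewrite lee_fin.
Qed.

Lemma esum_exchange T T' (S : set T) (S' : set T') (a : T -> T' -> \bar R) :
  (forall i j, 0 <= a i j)%E ->
  (\esum_(i in S) (\esum_(j in S') a i j) = \esum_(j in S') (\esum_(i in S) a i j))%E.
Proof.
move=> a0; rewrite esum_esum// esum_esum//.
rewrite (reindex_esum (S' `*`` (fun=> S)) _ swap_pair)//.
split=> [[i j] []//|[i j] [i' j'] _ _ [-> ->]//|[i j] [Si Sj]].
by exists (j, i).
Qed.

Lemma esum_cst T (S : set T) (c : R) : 0 <= c -> (infinite_set S -> c = 0) ->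
  (\esum_(i in S) c%:E = (c * #|` fset_set S|%:R)%:E)%E.
Proof.
move=> c0 Sc; have [fS|iS] := pselect (finite_set S).
  rewrite esum_fset//.
  rewrite fsbig_finite//= sumEFin big_const_seq count_predT iter_addr addr0.
  by rewrite mulr_natr.
by rewrite (Sc iS) mul0r esum1.
Qed.

Lemma sum_inv_gapT : (\sum_(n <oo) (inv_gap n)%:E = 1%:E :> \bar R)%E.
Proof.
rewrite -[in RHS]invr1 -(sum_inv_gap 0).
by apply: eq_eseriesr => n _; rewrite leq0n mulr1.
Qed.

Lemma inv_card_le1 T (S : set T) : inv_card S <= 1 :> R.
Proof.
rewrite /inv_card; case: ifP => // _.
case: #|` _| => [|n]; first by rewrite invr0.
by rewrite invf_le1 ?ltr0n// ler1n.
Qed.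

Lemma inv_card_ge0 T (S : set T) : 0 <= inv_card S :> R.
Proof. by rewrite /inv_card; case: ifP. Qed.

(** Passing from S to S' jumps over the size n + 1; each such jump is worth [inv_gap n]. *)
Definition gap_hit T (S S' : set T) n : bool :=
  ((card_sum S <= (n.+1%:R%:E : \bar R)) && (n.+1%:R%:E < (card_sum S' : \bar R)))%E.

Lemma inv_card_gap T (S S' : set T) : S !=set0 -> S `<=` S' ->
  ((inv_card S - inv_card S' : R)%:E =
   \sum_(n <oo) (inv_gap n * (gap_hit S S' n)%:R)%:E)%E.
Proof.
move=> S0 SS'; have S'0 : S' !=set0 by have [x /SS' ?] := S0; exists x.
suff E : ((inv_card S)%:E = \sum_(n <oo) (inv_gap n * (gap_hit S S' n)%:R)%:E +
    (inv_card S' : R)%:E)%E by rewrite EFinB E addeK.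
rewrite !inv_cardE// -nneseriesD; last 2 first.
- by move=> n _ _; rewrite lee_fin mulr_ge0// inv_gap_ge0.
- by move=> n _ _; rewrite lee_fin mulr_ge0// inv_gap_ge0.
apply: eq_eseriesr => n _; rewrite -EFinD -mulrDr -natrD; congr (_ * _%:R)%:E.
rewrite /gap_hit; have := le_card_sum SS' => le.
case: (leP (card_sum S) _) => /= [SN|NS]; case: (leP (card_sum S') _) => //= S'N.
by move: NS; rewrite ltNge (le_trans le S'N).
Qed.

Lemma one_sub_inv_card T (S : set T) : S !=set0 ->
  ((1 - inv_card S : R)%:E =
   \sum_(n <oo) (inv_gap n * (n.+1%:R%:E < (card_sum S : \bar R))%E%:R)%:E)%E.
Proof.
move=> S0.
suff E : (1%:E = \sum_(n <oo) (inv_gap n * (n.+1%:R%:E < (card_sum S : \bar R))%E%:R)%:E +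
    (inv_card S : R)%:E)%E by rewrite EFinB [in LHS]E addeK.
rewrite inv_cardE// -sum_inv_gapT -nneseriesD; last 2 first.
- by move=> n _ _; rewrite lee_fin mulr_ge0// inv_gap_ge0.
- by move=> n _ _; rewrite lee_fin mulr_ge0// inv_gap_ge0.
apply: eq_eseriesr => n _; rewrite -EFinD -mulrDr -natrD.
by rewrite ltNge; case: (_ <= _)%E; rewrite mulr1.
Qed.

End CardSum.

(** A strict total order on unordered edges, carried by ordered pairs: the two orientations of an
    edge are incomparable and compare alike with all others. *)
Record edge_order (T : Type) (lt : T * T -> T * T -> Prop) : Prop := EdgeOrder {
  eo_irr : forall p, ~ lt p p;
  eo_trans : forall p q r, lt p q -> lt q r -> lt p r;
  eo_swapl : forall p q, lt p q -> lt (swap_pair p) q;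
  eo_swapr : forall p q, lt p q -> lt p (swap_pair q);
  eo_total : forall p q, [\/ lt p q, lt q p, p = q | p = swap_pair q] }.

Section WiredForest.
Context d (J : measurableType d) (R : realType).
Variable lt : J * J -> J * J -> Prop.
Implicit Types (A : set (J * J)) (p q : J * J) (z : J).

Definition above A p : set (J * J) := [set q | A q /\ lt p q].
Definition not_below A p : set (J * J) := [set q | A q /\ ~ lt q p].

(* Kruskal's algorithm run downwards in the order [lt], with all infinite
   components treated as already joined at infinity. *)
Definition wired_forest A : set (J * J) := [set p |
  [/\ A p, ~ comp (above A p) p.1 p.2 &
      finite_set (comp (above A p) p.1) \/ finite_set (comp (above A p) p.2)]].

Definition drop A z p : R := inv_comp R (above A p) z - inv_comp R (not_below A p) z.

Hypothesis lt_order : edge_order lt.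

Let lt_irr := eo_irr lt_order.
Let lt_trans := eo_trans lt_order.
Let lt_swapl := eo_swapl lt_order.
Let lt_swapr := eo_swapr lt_order.
Let lt_total := eo_total lt_order.

Let lt_asym p q : lt p q -> ~ lt q p.
Proof. by move=> pq qp; exact: lt_irr (lt_trans pq qp). Qed.

Let swapK p : swap_pair (swap_pair p) = p. Proof. by case: p. Qed.

Lemma above_sym A p : symmetric_edges A -> symmetric_edges (above A p).
Proof. by move=> sA x y [/sA ? /lt_swapr]. Qed.

Lemma above_swap A p : above A (swap_pair p) = above A p.
Proof.
apply/seteqP; split=> q [Aq] /lt_swapl; last by [].
by rewrite swapK.
Qed.

Lemma not_below_swap A p : not_below A (swap_pair p) = not_below A p.
Proof.
apply/seteqP; split=> q [Aq nlt]; split=> // /lt_swapr//.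
by rewrite swapK.
Qed.

Lemma above_not_below A p : above A p `<=` not_below A p.
Proof. by move=> q [Aq pq]; split=> //; exact: lt_asym. Qed.

Lemma not_belowE A p : symmetric_edges A -> A p ->
  not_below A p = add_edge (above A p) p.
Proof.
move=> sA Ap; apply/seteqP; split=> q.
  case=> Aq nqp; case: (lt_total p q) => [pq|/nqp[]|->|->].
  - by left.
  - by right; left.
  - by right; right; rewrite swapK.
case=> [/above_not_below//|[->|->]]; split=> //.
- by case: p Ap => x y /=; exact: sA.
- by move=> /lt_swapl; rewrite swapK; exact: lt_irr.
Qed.

Lemma drop_ge0 A z p : symmetric_edges A -> 0 <= drop A z p.
Proof.
move=> sA; rewrite -lee_fin /drop (@inv_card_gap R _ (comp (above A p) z)).
- by apply: nneseries_ge0 => n _ _; rewrite lee_fin mulr_ge0// inv_gap_ge0.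
- by exists z; exact: comp_refl.
- by apply: comp_subset; exact: above_not_below.
Qed.

(** Let X and Y be the components of the two ends above p. If X = Y nothing drops. If they are
    distinct and finite, the total is |X|/|X| + |Y|/|Y| - (|X| + |Y|)/|X u Y| = 1; if only one is
    finite, its vertices drop to 0 and contribute 1 while the infinite side contributes 0; if both
    are infinite nothing drops. *)
Lemma esum_drop A p (S : set J) : symmetric_edges A -> A p ->
  comp (above A p) p.1 `<=` S -> comp (above A p) p.2 `<=` S ->
  (\esum_(z in S) (drop A z p)%:E = (\1_(wired_forest A) p)%:E)%E.
Proof.
case: p => x y sA Ap /= xS yS.
set B := above A (x, y); set B' := not_below A (x, y).
have sB : symmetric_edges B by exact: above_sym.
have BE' : B' = add_edge B (x, y) by exact: not_belowE.
pose X := comp B x; pose Y := comp B y.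
have dropE z : drop A z (x, y) = inv_card (comp B z) - inv_card (comp B' z) by [].
have [xy|nxy] := pselect (comp B x y).
  rewrite esum1 => [|z _]; last by rewrite dropE BE' comp_add_redundant// subrr.
  by rewrite indicE memNset// => -[].
have XY0 z : X z -> ~ Y z.
  by move=> xz yz; apply: nxy; apply: comp_trans xz (comp_sym sB yz).
have dropX z : X z -> drop A z (x, y) = inv_card X - inv_card (X `|` Y).
  by move=> xz; rewrite dropE BE' comp_add_in; [rewrite -(comp_eq sB xz)| |left].
have dropY z : Y z -> drop A z (x, y) = inv_card Y - inv_card (X `|` Y).
  by move=> yz; rewrite dropE BE' comp_add_in; [rewrite -(comp_eq sB yz)| |right].
have dropN z : ~ (X `|` Y) z -> drop A z (x, y) = 0.
  move=> nz; rewrite dropE BE' comp_add_out ?subrr// => xz; apply: nz.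
    by left.
  by right.
have infU (Z : set J) : Z `<=` X `|` Y -> infinite_set Z -> inv_card (X `|` Y) = 0 :> R.
  move=> ZU iZ; rewrite /inv_card; case: asboolP => // fU.
  by case: iZ; exact: sub_finite_set ZU fU.
have inv0 (Z : set J) : infinite_set Z -> inv_card Z = 0 :> R.
  by move=> iZ; rewrite /inv_card; case: asboolP.
have X_inf : infinite_set X -> inv_card X - inv_card (X `|` Y) = 0 :> R.
  by move=> iX; rewrite inv0// (infU X)// ?subrr//; exact: subsetUl.
have Y_inf : infinite_set Y -> inv_card Y - inv_card (X `|` Y) = 0 :> R.
  by move=> iY; rewrite inv0// (infU Y)// ?subrr//; exact: subsetUr.
have -> : (\esum_(z in S) (drop A z (x, y))%:E =
    \esum_(z in X) (inv_card X - inv_card (X `|` Y) : R)%:E +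
    \esum_(z in Y) (inv_card Y - inv_card (X `|` Y) : R)%:E)%E.
  rewrite (esumID X); last by move=> z _; rewrite lee_fin drop_ge0.
  rewrite setIidr//; congr (_ + _)%E; first by apply: eq_esum => z /dropX ->.
  rewrite (esumID Y); last by move=> z _; rewrite lee_fin drop_ge0.
  rewrite [X in (_ + X)%E]esum1 ?adde0; last first.
    by move=> z [[_ nX] nY]; rewrite dropN// => -[].
  rewrite (_ : S `&` ~` X `&` Y = Y); first by apply: eq_esum => z /dropY ->.
  apply/seteqP; split=> [z []//|z Yz]; split=> //; split; first exact: yS.
  by move=> /XY0.
rewrite !esum_cst//; last 2 first.
- have [z Yz] : Y !=set0 by exists y; exact: comp_refl.
  by rewrite -(dropY z Yz) drop_ge0.
- have [z Xz] : X !=set0 by exists x; exact: comp_refl.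
  by rewrite -(dropX z Xz) drop_ge0.
have card_neq0 (Z : set J) z : finite_set Z -> Z z -> (#|` fset_set Z|)%:R != 0 :> R.
  move=> fZ Zz; rewrite pnatr_eq0 -lt0n cardfs_gt0; apply/fset0Pn; exists z.
  by rewrite in_fset_set// inE.
have Xx : X x by exact: comp_refl.
have Yy : Y y by exact: comp_refl.
have invE (Z : set J) : finite_set Z -> inv_card Z = (#|` fset_set Z|%:R)^-1 :> R.
  by move=> fZ; rewrite /inv_card; case: asboolP.
rewrite -EFinD; congr EFin; rewrite indicE.
have [fX|iX] := pselect (finite_set X); have [fY|iY] := pselect (finite_set Y).
- rewrite mem_set; last by split=> //; left.
  have cU : #|` fset_set (X `|` Y)| = (#|` fset_set X| + #|` fset_set Y|)%N.
    rewrite fset_setU// cardfsU -fset_setI//.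
    rewrite (_ : X `&` Y = set0) ?fset_set0 ?cardfs0 ?subn0//.
    by apply/seteqP; split=> z // [/XY0].
  have fU : finite_set (X `|` Y) by rewrite finite_setU.
  rewrite !invE// !mulrBl !mulVf ?(card_neq0 X x) ?(card_neq0 Y y)//.
  rewrite addrACA -opprD -mulrDr -natrD -cU mulVf ?(card_neq0 _ x)//; last by left.
  by rewrite addrK.
- rewrite mem_set; last by split=> //; left.
  rewrite Y_inf// mul0r addr0 (infU Y (@subsetUr _ X Y) iY) subr0.
  by rewrite invE// mulVf// (card_neq0 X x).
- rewrite mem_set; last by split=> //; right.
  rewrite X_inf// mul0r add0r (infU X (@subsetUl _ X Y) iX) subr0.
  by rewrite invE// mulVf// (card_neq0 Y y).
- by rewrite memNset ?X_inf ?Y_inf ?mul0r ?addr0// => -[_ _ []].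
Qed.

Variable A : set (J * J).
Hypotheses (sA : symmetric_edges A) (locfin : forall x, finite_set (nbrE A x)).

Let lt_maximal (S : set (J * J)) : finite_set S -> S !=set0 ->
  exists2 p, S p & forall q, S q -> ~ lt p q.
Proof. exact: strict_order_maximal. Qed.

(** If q lies above p, all edges not below q lie above p; the component of z after adding q is then
    inside one of size at most n + 1, so q cannot jump over n + 1. *)
Lemma gap_hit_unique z n p q : A p -> A q ->
  @gap_hit R _ (comp (above A p) z) (comp (not_below A p) z) n ->
  @gap_hit R _ (comp (above A q) z) (comp (not_below A q) z) n ->
  p = q \/ p = swap_pair q.
Proof.
have lem p' q' : A q' -> lt p' q' ->
  @gap_hit R _ (comp (above A p') z) (comp (not_below A p') z) n ->
  ~ @gap_hit R _ (comp (above A q') z) (comp (not_below A q') z) n.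
  move=> Aq' pq /andP[hp _] /andP[_]; rewrite ltNge => /negP; apply.
  apply: le_trans hp; apply: le_card_sum; apply: comp_subset => r [Ar nrq].
  split=> //; case: (lt_total p' r) => // [rp|E|E].
  - by case: nrq; exact: lt_trans rp pq.
  - by case: nrq; rewrite -E.
  - by case: nrq; rewrite -[r]swapK -E; exact: lt_swapl.
move=> Ap Aq hp hq; case: (lt_total p q) => [pq|qp|->|->].
- by case: (lem p q Aq pq).
- by case: (lem q p Ap qp).
- by left.
- by right.
Qed.

(* Maximise, among the components of [z] seen at levels of [lt], the size below
   the threshold; the highest edge leaving that component is the jump. *)
Lemma gap_hit_exists z n : (n.+1%:R%:E < (card_sum (comp A z) : \bar R))%E ->
  exists2 p, A p & @gap_hit R _ (comp (above A p) z) (comp (not_below A p) z) n.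
Proof.
rewrite ltNge => /negP nA.
pose good (C : set J) := [/\ finite_set C, (#|` fset_set C| <= n.+1)%N &
  C = [set z] \/ exists2 q, A q & C = comp (not_below A q) z].
pose P k := `[< exists2 C, good C & #|` fset_set C| = k >].
have exP : exists k, P k.
  exists 1%N; apply/asboolP; exists [set z]; last by rewrite fset_set1 cardfs1.
  by split; [exact: finite_set1|rewrite fset_set1 cardfs1|left].
have boundP k : P k -> (k <= n.+1)%N by move=> /asboolP[C [_ + _] <-].
have [k /asboolP[C [fC Cn Cform] Ck] kmax] := ex_maxnP exP boundP.
have Cz : C z by case: Cform => [->//|[q _ ->]]; exact: comp_refl.
pose Bd : set (J * J) := [set p | [/\ A p, C p.1 & ~ C p.2]].
have fBd : finite_set Bd.
  have sub : Bd `<=` \bigcup_(x in C) [set (x, y) | y in nbrE A x].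
    by move=> [x y] [Axy Cx _]; exists x => //; exists y.
  apply: sub_finite_set sub _; apply: bigcup_finite => // x _.
  exact: finite_image.
have Bd0 : Bd !=set0.
  apply: contrapT => nBd; apply: nA; apply/card_sum_leP.
  have sub : comp A z `<=` C.
    apply: comp_closed => // x y Cx Axy; apply: contrapT => nCy.
    by apply: nBd; exists (x, y).
  split; first exact: sub_finite_set sub fC.
  apply: leq_trans Cn; apply: fsubset_leq_card.
  by rewrite -fset_set_sub//; exact: sub_finite_set sub fC.
have [p [Ap Cp1 nCp2] pmax] := lt_maximal fBd Bd0.
exists p => //; apply/andP; split.
  have sub : comp (above A p) z `<=` C.
    apply: comp_closed => // x y Cx [Axy pxy]; apply: contrapT => nCy.
    exact: (pmax (x, y)).
  by apply: le_trans (le_card_sum sub) _; apply/card_sum_leP.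
rewrite ltNge; apply/negP => /card_sum_leP[fU Un].
have /kmax : P #|` fset_set (comp (not_below A p) z)|.
  by apply/asboolP; eexists; last by []; split=> //; right; exists p.
rewrite -Ck leqNgt => /negP; apply.
(* If C is seen at a level q below p, then p is already available there and its far end would belong
   to C; otherwise the edges not below q are also not below p. Adding [p.2] then contradicts the
   maximal size of C. *)
have CU : C `<=` comp (not_below A p) z.
  case: Cform => [->|[q Aq CE]]; first by move=> _ ->; exact: comp_refl.
  have [qp|nqp] := pselect (lt q p).
    case: nCp2; rewrite CE; apply: (@comp_trans _ _ _ p.1); first by rewrite -CE.
    by apply: comp_edge; rewrite -surjective_pairing; split=> //; exact: lt_asym.
  rewrite CE; apply: comp_subset => r [Ar nrq]; split=> // rp.
  case: (lt_total p q) => // [pq|E|E].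
  - by apply: nrq; exact: lt_trans rp pq.
  - by apply: nrq; rewrite -E.
  - by apply: nrq; rewrite -[q]swapK -E; exact: lt_swapr.
have Up2 : comp (not_below A p) z p.2.
  apply: (@comp_trans _ _ _ p.1); first exact: CU.
  by apply: comp_edge; rewrite -surjective_pairing; split.
apply: fproper_ltn_card; rewrite fproperE; apply/andP; split.
  by apply/fsubsetP => x; rewrite !in_fset_set// !inE; exact: CU.
apply/negP => /fsubsetP/(_ p.2).
by rewrite !in_fset_set// !inE => /(_ Up2).
Qed.

Lemma gap_hit_comp z n p : A p ->
  @gap_hit R _ (comp (above A p) z) (comp (not_below A p) z) n -> comp A z p.1.
Proof.
case: p => x y Axy /= /andP[hle hlt].
have subA : above A (x, y) `<=` A by move=> q [].
have sB := @above_sym A (x, y) sA.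
have [xz|nxz] := pselect (comp (above A (x, y)) x z).
  exact: comp_subset subA _ (comp_sym sB xz).
have [yz|nyz] := pselect (comp (above A (x, y)) y z).
  apply: comp_trans (comp_edge (sA Axy)).
  exact: comp_subset subA _ (comp_sym sB yz).
move: hlt; rewrite (not_belowE sA Axy) comp_add_out// => hlt.
by have := lt_le_trans hlt hle; rewrite ltxx.
Qed.

(** Selects one orientation of each edge, so that sums over ordered pairs count an edge once. *)
Variable low : set (J * J).
Hypothesis low_swap : forall p, A p -> low (swap_pair p) <-> ~ low p.

(** After exchanging the sums, each n with n + 1 below the size of the component of z in A is jumped
    over by exactly one selected edge, and every other n by none; the weights [inv_gap n] of the
    former add up to 1 - 1/|component|. *)
Lemma esum_drop_edges z (P : set (J * J)) :
  (forall p, A p -> comp A z p.1 -> P p) ->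
  (\esum_(p in P) (drop A z p * \1_(A `&` low) p)%:E =
   (1 - inv_comp R A z)%:E)%E.
Proof.
move=> AP; pose hit p n := @gap_hit R _ (comp (above A p) z) (comp (not_below A p) z) n.
have term0 p n : (0 <= (inv_gap n * (hit p n)%:R * \1_(A `&` low) p : R)%:E)%E.
  by rewrite lee_fin !mulr_ge0// inv_gap_ge0.
have dropE p : ((drop A z p * \1_(A `&` low) p)%:E =
    \esum_(n in setT) (inv_gap n * (hit p n)%:R * \1_(A `&` low) p)%:E)%E.
  rewrite EFinM (@inv_card_gap R _ (comp (above A p) z)); last 2 first.
  - by exists z; exact: comp_refl.
  - by apply: comp_subset; exact: above_not_below.
  rewrite -nneseries_esumT// muleC -nneseriesZl//; last first.
    by move=> n _; rewrite lee_fin mulr_ge0// inv_gap_ge0.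
  by apply: eq_eseriesr => n _; rewrite -EFinM mulrC.
under eq_esum do rewrite dropE.
rewrite esum_exchange// (@one_sub_inv_card R _ (comp A z)); last first.
  by exists z; exact: comp_refl.
rewrite nneseries_esumT; last by move=> n; rewrite lee_fin mulr_ge0// inv_gap_ge0.
apply: eq_esum => n _.
have [ltn|nlt] := boolP (n.+1%:R%:E < (card_sum (comp A z) : \bar R))%E; last first.
  rewrite mulr0 esum1// => p _; have [[Ap lp]|nAp] := pselect ((A `&` low) p).
    have -> : hit p n = false; last by rewrite mulr0 mul0r.
    apply/negP => /andP[_ hlt]; move/negP : nlt; apply; apply: lt_le_trans hlt _.
    by apply: le_card_sum; apply: comp_subset => q [].
  by rewrite indicE memNset// mulr0.
have [p0 [Ap0 lp0] hp0] : exists2 p, (A `&` low) p & hit p n.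
  have [p Ap hp] := gap_hit_exists ltn.
  have [lp|nlp] := pselect (low p); first by exists p.
  exists (swap_pair p); last by rewrite /hit above_swap not_below_swap.
  split; last exact/low_swap.
  by case: p Ap {hp nlp} => x y; exact: sA.
rewrite (esum_single (y0 := p0))//; last first.
  move=> q _ qp0; have [[Aq lq]|nAq] := pselect ((A `&` low) q); last first.
    by rewrite indicE memNset// mulr0.
  have [hq|_] := boolP (hit q n); last by rewrite mulr0 mul0r.
  have [//|qE] := gap_hit_unique Aq Ap0 hq hp0.
  by move: lq; rewrite qE => /(low_swap Ap0).
rewrite mem_set; last by apply: AP => //; exact: gap_hit_comp hp0.
by rewrite hp0 indicE mem_set// !mulr1.
Qed.

End WiredForest.

(** * The rank of an edge set as the measure of its forest *)

Section RankForest.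
Context d (J : measurableType d) (R : realType) (mu : probability J R).
Context (phi : J -> R) (adj : J -> J -> Prop) (h : nat -> J -> J) (D : nat).
Context (lt : J * J -> J * J -> Prop).
Local Notation E := (Edir adj).
Hypothesis graphing : enumerated_graphing mu phi adj h D.
Hypothesis lt_order : edge_order lt.
Hypothesis mlt : measurable [set pq : (J * J) * (J * J) | lt pq.1 pq.2].

Let mphi := eg_mphi graphing.
Let phi_inj := eg_phi_inj graphing.
Let mE := eg_mE graphing.
Let mh := eg_mh graphing.
Let h_cover := eg_cover graphing.

Let E_sym x y : E (x, y) -> E (y, x). Proof. exact: (eg_sym graphing). Qed.

Lemma edge_subset_sym A : edge_subset adj A -> symmetric_edges A.
Proof. by case. Qed.

Lemma edge_subset_locfin A x : edge_subset adj A -> finite_set (nbrE A x).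
Proof.
case=> _ AE _; apply: sub_finite_set (eg_deg graphing x).1.
by move=> y /AE.
Qed.

Section Subset.
Variable A : set (J * J).
Hypothesis A_edge : edge_subset adj A.

Let mA : measurable A. Proof. by case: A_edge. Qed.
Let AE : A `<=` E. Proof. by case: A_edge. Qed.
Let sA := edge_subset_sym A_edge.

Let mpre dX dY (X : measurableType dX) (Y : measurableType dY) (f : X -> Y) (S : set Y) :
  measurable_fun setT f -> measurable S -> measurable [set x | S (f x)].
Proof. by move=> mf mS; have := mf measurableT _ mS; rewrite setTI. Qed.

Let mabove dX (X : measurableType dX) (p : X -> J * J) : measurable_fun setT p ->
  measurable [set q : X * (J * J) | above lt A (p q.1) q.2].
Proof.
move=> mp; apply: measurableI; first exact: (mpre (@measurable_snd _ _ _ _) mA).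
apply: (mpre (f := fun q : X * (J * J) => (p q.1, q.2)) _ mlt).
by apply: measurable_fun_pair => //; exact: measurableT_comp.
Qed.

Let mnot_below dX (X : measurableType dX) (p : X -> J * J) : measurable_fun setT p ->
  measurable [set q : X * (J * J) | not_below lt A (p q.1) q.2].
Proof.
move=> mp; apply: measurableI; first exact: (mpre (@measurable_snd _ _ _ _) mA).
apply: measurableC.
apply: (mpre (f := fun q : X * (J * J) => (q.2, p q.1)) _ mlt).
by apply: measurable_fun_pair => //; exact: measurableT_comp.
Qed.

Let aboveE p : above lt A p `<=` E. Proof. by move=> q [/AE]. Qed.
Let not_belowE' p : not_below lt A p `<=` E. Proof. by move=> q [/AE]. Qed.

Lemma measurable_wired_forest : measurable (wired_forest lt A).
Proof.
have mfin (f : J * J -> J) : measurable_fun setT f ->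
    measurable [set p | finite_set (comp (above lt A p) (f p))].
  move=> mf; have mc := measurable_card_comp mphi phi_inj E_sym mh h_cover mf
    aboveE (mabove (@measurable_id _ _ setT)).
  rewrite [X in measurable X](_ : _ = [set p | (~` [set +oo%E])
      (card_sum (comp (above lt A p) (f p)) : \bar R)]).
    by apply: mpre mc _; apply: measurableC.
  apply/seteqP; split=> p /=.
    by move=> fin; rewrite card_sum_fin.
  by move=> ninf; apply: contrapT => /card_sum_inf.
rewrite [X in measurable X](_ : _ = A `&` (
   ~` [set p | comp (above lt A p) p.1 p.2] `&`
   ([set p | finite_set (comp (above lt A p) p.1)] `|`
    [set p | finite_set (comp (above lt A p) p.2)]))); last first.
  by apply/seteqP; split=> p [] // ? [].
apply: measurableI => //; apply: measurableI; last first.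
  by apply: measurableU; exact: mfin.
apply: measurableC.
have mc := measurable_comp mphi phi_inj E_sym mh h_cover (@measurable_fst _ _ J J)
    aboveE (mabove (@measurable_id _ _ setT)).
apply: (mpre (f := fun p : J * J => (p, p.2)) _ mc).
by apply: measurable_fun_pair => //; exact: measurable_id.
Qed.

Lemma wired_forest_edge_subset : edge_subset adj (wired_forest lt A).
Proof.
split; [exact: measurable_wired_forest|by move=> p [/AE]|].
move=> x y [Axy nc fin]; have E1 := above_swap lt_order A (x, y).
split; [exact: sA| |]; rewrite /= -E1 in nc fin *.
  by move=> c; apply: nc; apply: comp_sym => //; exact: above_sym.
by case: fin; [right|left].
Qed.

Let low : set (J * J) := [set p | phi p.1 < phi p.2].

Let mlow : measurable low.
Proof.
have mb : measurable_fun setT (fun p : J * J => phi p.1 < phi p.2).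
  by apply: measurable_fun_ltr; exact: measurableT_comp.
by have := mb measurableT [set true] I; rewrite setTI.
Qed.

Let low_swapE p : E p -> low (swap_pair p) <-> ~ low p.
Proof.
case: p => x y Exy; rewrite /low /=; case: ltgtP => // xy; split=> //.
move: Exy; rewrite (phi_inj xy) => /(eg_irr graphing).
by [].
Qed.

Let low_swap p : A p -> low (swap_pair p) <-> ~ low p.
Proof. by move=> /AE; exact: low_swapE. Qed.

Local Open Scope ereal_scope.

Let weight (z : J) (p : J * J) : \bar R := (drop R lt A z p * \1_(A `&` low) p)%:E.

Let weight_ge0 z p : 0 <= weight z p.
Proof. by rewrite lee_fin mulr_ge0// drop_ge0. Qed.

Let mweight : measurable_fun setT (fun zp : J * (J * J) => weight zp.1 zp.2).
Proof.
apply/measurable_EFinP; apply: measurable_funM; last first.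
  by apply: measurableT_comp => //; apply: measurable_indic; exact: measurableI.
apply: (@measurable_funB _ _ _ _
  (fun zp : J * (J * J) => inv_comp R (above lt A zp.2) zp.1)
  (fun zp : J * (J * J) => inv_comp R (not_below lt A zp.2) zp.1)).
- exact: (measurable_inv_comp mphi phi_inj E_sym mh h_cover (@measurable_fst _ _ _ _)
    (fun zp => @aboveE zp.2) (mabove (@measurable_snd _ _ _ _))).
- exact: (measurable_inv_comp mphi phi_inj E_sym mh h_cover (@measurable_fst _ _ _ _)
    (fun zp => @not_belowE' zp.2) (mnot_below (@measurable_snd _ _ _ _))).
Qed.

(** Mass transport moves mass between vertices, so the mass meant for an edge is delivered at its
    end with smaller [phi]. *)
Let transport (zx : J * J) : \bar R := \esum_(y in nbrE E zx.2) weight zx.1 (zx.2, y).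

Let transport_ge0 zx : 0 <= transport zx.
Proof. by apply: esum_ge0. Qed.

Let mtransport : measurable_fun setT transport.
Proof.
pose V n := [set zx : J * J | E (zx.2, h n zx.2)].
pose theta n (zx : J * J) := h n zx.2.
pose f (q : (J * J) * J) := weight q.1.1 (q.1.2, q.2).
have mtheta n : measurable_fun setT (theta n) by exact: measurableT_comp.
have mV n : measurable (V n).
  apply: (mpre (f := fun zx : J * J => (zx.2, h n zx.2)) _ mE).
  by apply: measurable_fun_pair => //; exact: mtheta.
have Kenum (zx : J * J) y : nbrE E zx.2 y <-> exists n, V n zx /\ theta n zx = y.
  split=> [Exy|[n [Vn <-]]//].
  by have [n nE] := h_cover Exy; exists n; rewrite /V /theta /= nE.
have mf : measurable_fun setT f.
  have mg : measurable_fun setT (fun q : (J * J) * J => (q.1.1, (q.1.2, q.2))).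
    by apply: measurable_fun_pair; [exact: measurableT_comp|
       apply: measurable_fun_pair => //; exact: measurableT_comp].
  exact: (measurableT_comp mweight mg).
apply: (measurable_esum_sections mphi phi_inj mV mtheta Kenum _ mf) => q.
exact: weight_ge0.
Qed.

Let transport_out z : \esum_(x in comp E z) transport (z, x) = (1 - inv_comp R A z)%:E.
Proof.
rewrite /transport /= esum_esum//.
rewrite (_ : (fun k => weight z (k.1, k.2)) = weight z); last first.
  by apply/funext => -[].
apply: (esum_drop_edges R lt_order sA (fun x => edge_subset_locfin x A_edge) low_swap).
move=> [x y] Axy zx; split=> /=; last exact: AE.
exact: comp_subset AE _ zx.
Qed.

Let transport_in x : \esum_(z in comp E x) transport (z, x) =
  nbr_sum adj (EFin \o \1_(wired_forest lt A `&` low)) x.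
Proof.
rewrite /transport /= esum_exchange//; apply: eq_esum => y Exy /=.
have [[Axy lxy]|nAl] := pselect ((A `&` low) (x, y)); last first.
  rewrite esum1 => [|z _]; last by rewrite /weight indicE memNset// mulr0.
  by rewrite indicE memNset// => -[[? _ _] ?]; apply: nAl.
rewrite (_ : (fun z => _) = fun z => (drop R lt A z (x, y))%:E); last first.
  by apply/funext => z; rewrite /weight indicE mem_set// mulr1.
rewrite (esum_drop R lt_order sA Axy)/=; last 2 first.
- by apply: comp_subset; exact: aboveE.
- rewrite (comp_eq E_sym (comp_edge Exy)).
  by apply: comp_subset; exact: aboveE.
rewrite !indicE; congr (nat_of_bool _)%:R%:E.
by apply/idP/idP; rewrite !inE; [split|case].
Qed.

(** The other orientation of the edges contributes as much by [edge_transport]; the factor 2 cancels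
    the one half in [eta]. *)
Lemma integral_deg_low F : edge_subset adj F ->
  \int[mu]_x ((degE F x)%:R : R)%:E =
  2%:E * \int[mu]_x nbr_sum adj (EFin \o \1_(F `&` low)) x.
Proof.
move=> F_edge; have [mF FE sF] := F_edge.
have mFl : measurable (F `&` low) by exact: measurableI.
have mind (S : set (J * J)) : measurable S ->
    measurable_fun setT (EFin \o \1_S : J * J -> \bar R).
  by move=> mS; apply/measurable_EFinP; exact: measurable_indic.
have ind0 (S : set (J * J)) p : 0 <= (EFin \o \1_S : J * J -> \bar R) p.
  by rewrite /= lee_fin.
rewrite (_ : 2%:E = 1 + 1); last by rewrite -EFinD.
rewrite ge0_muleDl// mul1e [X in _ + X](edge_transport graphing)//; last exact: mind.
rewrite -ge0_integralD//; last 4 first.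
- by move=> x _; exact: nbr_sum_ge0.
- by apply: (measurable_nbr_sum graphing) => //; exact: mind.
- by move=> x _; apply: nbr_sum_ge0 => p; exact: ind0.
- apply: (measurable_nbr_sum graphing) => [p|]; first exact: ind0.
  exact: (measurableT_comp (mind _ mFl) (@measurable_swap _ _ J J)).
apply: eq_integral => x _; rewrite -(nbr_sum_deg graphing)// /nbr_sum -esumD//; last first.
  by move=> y _; exact: ind0.
apply: eq_esum => y Exy; rewrite /= -EFinD !indicE -natrD; congr (_%:R%:E).
have ls := low_swapE Exy; rewrite /= in ls.
have [Fxy|nF] := pselect (F (x, y)); last first.
  rewrite !memNset// => -[]// /sF; by [].
rewrite mem_set//; have [lxy|nl] := pselect (low (x, y)).
  rewrite [(x, y) \in _]mem_set// memNset// => -[_ /ls]; exact.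
rewrite [(x, y) \in _]memNset; last by case.
by rewrite mem_set//; split; [exact: sF|exact/ls].
Qed.

Theorem rank_wired_forest : rank mu A = eta mu (wired_forest lt A).
Proof.
rewrite /eta (integral_deg_low wired_forest_edge_subset) muleA -EFinM mulVf ?mul1e//.
have minv : measurable_fun setT (fun x => inv_comp R A x).
  apply: (measurable_inv_comp mphi phi_inj E_sym mh h_cover (@measurable_id _ J setT)
    (fun _ => AE)).
  exact: (mpre (@measurable_snd _ _ _ _) mA).
transitivity (\int[mu]_z (\esum_(x in comp E z) transport (z, x))).
  under [RHS]eq_integral do rewrite transport_out EFinB.
  have inv1 x : (0 <= inv_comp R A x <= 1)%R.
    by rewrite (@inv_card_ge0 R _ (comp A x)) (@inv_card_le1 R _ (comp A x)).
  have iinv : mu.-integrable setT (EFin \o inv_comp R A).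
    apply: (@le_integrable _ _ _ mu _ measurableT _ (cst 1)).
    - exact/measurable_EFinP.
    - move=> x _ /=; rewrite normr1 lee_fin ger0_norm; last by case/andP: (inv1 x).
      by case/andP: (inv1 x).
    - exact: finite_measure_integrable_cst.
  rewrite integralB//; last exact: finite_measure_integrable_cst.
  by rewrite /rank integral_cst//= probability_setT mule1.
rewrite (mass_transport graphing)//.
by apply: eq_integral => x _; rewrite transport_in.
Qed.

End Subset.
End RankForest.

(** * Integrals over edges *)

Section EdgeIntegral.
Context d (J : measurableType d) (R : realType) (mu : probability J R).
Context (phi : J -> R) (adj : J -> J -> Prop) (h : nat -> J -> J) (D : nat).
Local Notation E := (Edir adj).
Hypothesis graphing : enumerated_graphing mu phi adj h D.
Variable nu : {measure set (J * J) -> \bar R}.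
Local Open Scope ereal_scope.
Hypothesis nuP : forall f, (forall p, 0 <= f p) -> measurable_fun setT f ->
  \int[nu]_(p in E) f p = \int[mu]_x nbr_sum adj f x.

Let mE := eg_mE graphing.
Let finE x : finite_set (nbrE E x) := (eg_deg graphing x).1.

Lemma Edir_edge_subset : edge_subset adj E.
Proof. by split=> // x y; exact: (eg_sym graphing). Qed.

Let rsum (f : J * J -> R) x : R := (\sum_(y \in nbrE E x) f (x, y))%R.

Let patch_ge0 (f : J * J -> R) : (forall p, E p -> (0 <= f p)%R) ->
  forall p, 0 <= (EFin \o (f \_ E)) p.
Proof.
move=> f0 p; rewrite lee_fin patchE; case: ifPn => pE; last exact: lexx.
by apply: f0; rewrite inE in pE.
Qed.

Let rsum_nbr f x : (forall p, E p -> (0 <= f p)%R) ->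
  (rsum f x)%:E = nbr_sum adj (EFin \o (f \_ E)) x.
Proof.
move=> f0; rewrite /nbr_sum esum_fset//; last first.
  by move=> y _; exact: patch_ge0.
rewrite /rsum -fsumEFin//; apply: eq_fsbigr => y /[!inE] Exy.
by rewrite /= patchE mem_set.
Qed.

Let measurable_patch (f : J * J -> R) : measurable_fun E f ->
  measurable_fun setT (EFin \o (f \_ E)).
Proof. by move=> mf; apply/measurable_EFinP; apply/(measurable_restrictT f mE). Qed.

Let integral_rsum (f : J * J -> R) : measurable_fun E f -> (forall p, E p -> (0 <= f p)%R) ->
  \int[mu]_x (rsum f x)%:E = \int[nu]_(p in E) (f p)%:E.
Proof.
move=> mf f0; under eq_integral do rewrite rsum_nbr//.
rewrite -nuP; [|exact: patch_ge0|exact: measurable_patch].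
by apply: eq_integral => p pE; rewrite /= patchE pE.
Qed.

Let mrsum (f : J * J -> R) : measurable_fun E f -> (forall p, E p -> (0 <= f p)%R) ->
  measurable_fun setT (rsum f).
Proof.
move=> mf f0; apply/measurable_EFinP.
rewrite (_ : EFin \o _ = nbr_sum adj (EFin \o (f \_ E))); last first.
  by apply/funext => x /=; rewrite rsum_nbr.
by apply: (measurable_nbr_sum graphing); [exact: patch_ge0|exact: measurable_patch].
Qed.

Lemma eta_int_ge0E (f : J * J -> R) : measurable_fun E f -> (forall p, E p -> (0 <= f p)%R) ->
  eta_int mu adj f = 2^-1%:E * \int[nu]_(p in E) (f p)%:E.
Proof. by move=> mf f0; rewrite -integral_rsum. Qed.

(** Handled apart from the integrable case because it serves to discard the negative part of the
    density before its integrability is known. *)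
Lemma eta_int_oppE (f : J * J -> R) : measurable_fun E f -> (forall p, E p -> (0 <= f p)%R) ->
  eta_int mu adj (fun p => - f p)%R = - (2^-1%:E * \int[nu]_(p in E) (f p)%:E).
Proof.
move=> mf f0; rewrite -integral_rsum// -muleN; congr (_ * _).
rewrite -integral_ge0N; last first.
  by move=> x _; rewrite rsum_nbr//; apply: nbr_sum_ge0; exact: patch_ge0.
apply: eq_integral => x _; rewrite -EFinN; congr EFin.
by rewrite /rsum !fsbig_finite//= sumrN.
Qed.

Lemma eta_int_integrable (f : J * J -> R) : nu.-integrable E (EFin \o f) ->
  eta_int mu adj f = 2^-1%:E * \int[nu]_(p in E) (f p)%:E.
Proof.
move=> intf; have mf : measurable_fun E f.
  by apply/measurable_EFinP; exact: measurable_int intf.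
have ip := integrable_funepos mE intf; have im := integrable_funeneg mE intf.
pose fp p := Num.max (f p) 0%R; pose fm p := Num.max (- f p)%R 0%R.
have fp0 p : E p -> (0 <= fp p)%R by move=> _; rewrite le_max lexx orbT.
have fm0 p : E p -> (0 <= fm p)%R by move=> _; rewrite le_max lexx orbT.
have fpE : (EFin \o f)^\+ = EFin \o fp.
  by apply/funext => p; rewrite funeposE /= EFin_max.
have fmE : (EFin \o f)^\- = EFin \o fm.
  by apply/funext => p; rewrite funenegE /= EFin_max.
have mfp : measurable_fun E fp by apply: measurable_maxr => //; exact: measurable_cst.
have mfm : measurable_fun E fm.
  by apply: measurable_maxr => //; exact: measurable_funN.
have irs (f' : J * J -> R) : measurable_fun E f' -> (forall p, E p -> (0 <= f' p)%R) ->
    nu.-integrable E (EFin \o f') -> mu.-integrable setT (EFin \o rsum f').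
  move=> mf' f'0 /integrableP[_ fin]; apply/integrableP; split.
    by apply/measurable_EFinP; exact: mrsum.
  apply: le_lt_trans fin; rewrite le_eqVlt; apply/orP; left; apply/eqP.
  transitivity (\int[mu]_x (rsum f' x)%:E).
    apply: eq_integral => x _ /=; rewrite ger0_norm// -lee_fin rsum_nbr//.
    by apply: nbr_sum_ge0; exact: patch_ge0.
  rewrite integral_rsum//; apply: eq_integral => p /[!inE] Ep /=.
  by rewrite ger0_norm// f'0.
rewrite integralE fpE fmE /= /eta_int; congr (_ * _).
rewrite -!integral_rsum// -integralB_EFin//; last 2 first.
- by apply: irs => //; rewrite -fpE.
- by apply: irs => //; rewrite -fmE.
apply: eq_integral => x _; rewrite -EFinB; congr EFin.
rewrite /rsum !fsbig_finite//= -sumrB; apply: eq_bigr => y _; rewrite /fp /fm.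
case: (leP 0%R (f (x, y))) => f0.
  by rewrite max_r ?subr0// oppr_le0.
by rewrite max_l ?opprK ?add0r// oppr_ge0 ltW.
Qed.

Lemma eta_nu F : edge_subset adj F -> eta mu F = 2^-1%:E * nu F.
Proof.
case=> mF FE _; rewrite /eta; congr (_ * _).
under eq_integral do rewrite -(nbr_sum_deg graphing _ FE).
rewrite -nuP; last 2 first.
- by move=> p; rewrite /= lee_fin.
- by apply/measurable_EFinP; exact: measurable_indic.
by rewrite integral_indic// setIidl.
Qed.

Lemma eta_int_indic F : measurable F -> F `<=` E ->
  eta_int mu adj (\1_F) = 2^-1%:E * nu F.
Proof.
move=> mF FE; rewrite eta_int_ge0E//.
by rewrite integral_indic// setIidl.
Qed.

Section ForestMeasure.
Context (lt : J * J -> J * J -> Prop).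
Hypothesis lt_order : edge_order lt.
Hypothesis mlt : measurable [set pq : (J * J) * (J * J) | lt pq.1 pq.2].
Local Notation F := (wired_forest lt E).

(** Having fewer edges above p can neither connect its ends nor make a finite component infinite. *)
Lemma wired_forest_sub A A' : A `<=` A' -> A `&` wired_forest lt A' `<=` wired_forest lt A.
Proof.
move=> AA' p [Ap [_ nc fin]]; have sub : above lt A p `<=` above lt A' p.
  by move=> q [/AA' ? ?].
split=> //; first by move=> c; apply: nc; exact: comp_subset sub _ c.
by case: fin => fin; [left|right]; apply: sub_finite_set fin; exact: comp_subset.
Qed.

Lemma wired_forest_upper A : A `<=` E ->
  (forall p q, A p -> E q -> lt p q -> A q) -> wired_forest lt A = A `&` F.
Proof.
move=> AE up; apply/seteqP; split=> [p [Ap nc fin]|]; last exact: wired_forest_sub.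
have eqB : above lt A p = above lt E p.
  by apply/seteqP; split=> q [? pq]; split=> //; [exact: AE|exact: up pq].
by split=> //; rewrite eqB in nc fin; split=> //; exact: AE.
Qed.

Let F_edge : edge_subset adj F := wired_forest_edge_subset graphing lt_order mlt Edir_edge_subset.

Definition forest_measure (A : set (J * J)) : \bar R :=
  eta_int mu adj (fun p => \1_A p * \1_F p)%R.

Lemma forest_measureE A : edge_subset adj A -> forest_measure A = 2^-1%:E * nu (A `&` F).
Proof.
case=> mA AE _; have [mF _ _] := F_edge.
rewrite -eta_int_indic; [|exact: measurableI|by move=> p [/AE]].
by rewrite /forest_measure; congr eta_int; apply/funext => p; rewrite indicI.
Qed.

Lemma forest_measure_le_rank A : edge_subset adj A -> forest_measure A <= rank mu A.
Proof.
move=> eA; have [mA AE _] := eA; have [mF _ _] := F_edge.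
rewrite (rank_wired_forest graphing lt_order mlt eA).
have eFA := wired_forest_edge_subset graphing lt_order mlt eA.
rewrite forest_measureE// eta_nu// lee_pmul2l ?lte_fin//.
apply: le_measure; rewrite ?inE.
- exact: measurableI.
- by case: eFA.
- exact: wired_forest_sub.
Qed.

Lemma forest_measure_upper A : edge_subset adj A ->
  (forall p q, A p -> E q -> lt p q -> A q) -> forest_measure A = rank mu A.
Proof.
move=> eA up; rewrite (rank_wired_forest graphing lt_order mlt eA).
rewrite (eta_nu (wired_forest_edge_subset graphing lt_order mlt eA)).
rewrite (forest_measureE eA); congr (_ * nu _); apply/esym.
by apply: wired_forest_upper => //; case: eA.
Qed.

(** The total mass is right because E is itself an upper set of the order. *)
Lemma forest_measure_bmm : bmm_plus mu adj forest_measure.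
Proof.
have ge0 A : edge_subset adj A -> 0 <= forest_measure A.
  by move=> eA; rewrite forest_measureE// mule_ge0// lee_fin.
split; last by apply: forest_measure_upper => //; exact: Edir_edge_subset.
split; last by move=> A eA; split; [exact: ge0|exact: forest_measure_le_rank].
have [mF FE sF] := F_edge.
split=> //.
  rewrite forest_measureE; last by split.
  by rewrite set0I measure0 mule0.
move=> Fs eFs tFs.
have eU : edge_subset adj (\bigcup_n Fs n).
  split.
  - by apply: bigcupT_measurable => n; case: (eFs n).
  - by move=> p [n _]; case: (eFs n) => _ + _; apply.
  - by move=> x y [n _ Fxy]; exists n => //; case: (eFs n) => _ _; apply.
rewrite forest_measureE// setI_bigcupl.
rewrite [X in X @ _ --> _](_ : _ =
    (fun n => 2^-1%:E * \sum_(0 <= i < n) nu (Fs i `&` F))); last first.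
  apply/funext => n; rewrite ge0_sume_distrr//; apply: eq_bigr => i _.
  exact: forest_measureE.
apply: cvgeZl => //; apply: measure_semi_sigma_additive.
- by move=> n; apply: measurableI => //; case: (eFs n).
- apply/trivIsetP => i j _ _ ij; move/trivIsetP : tFs => /(_ i j I I ij).
  by rewrite setIACA => ->; rewrite set0I.
- apply: bigcupT_measurable => n; apply: measurableI => //; by case: (eFs n).
Qed.

End ForestMeasure.
End EdgeIntegral.

(** * Optimality of the forest *)

Section EdgeKey.
Context d (J : measurableType d) (R : realType) (phi : J -> R) (G : J * J -> R).
Hypotheses (mphi : measurable_fun setT phi) (phi_inj : injective phi)
  (mG : measurable_fun setT G) (G_sym : forall x y, G (x, y) = G (y, x)).

(** Lexicographic, so that G decides first; ties are broken by the larger and the smaller value of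
    [phi] at the ends, which together identify the unordered edge. *)
Definition edge_key (p : J * J) : R *l (R *l R) :=
  (G p, (Num.max (phi p.1) (phi p.2), Num.min (phi p.1) (phi p.2))).

Definition key_lt (p q : J * J) : Prop := (edge_key p < edge_key q)%O.

Lemma edge_key_swap p : edge_key (swap_pair p) = edge_key p.
Proof.
by case: p => x y; rewrite /edge_key /swap_pair /= G_sym maxC minC.
Qed.

Lemma key_lt_order : edge_order key_lt.
Proof.
rewrite /key_lt; split=> [p|p q r|p q|p q|p q].
- by rewrite ltxx.
- exact: lt_trans.
- by rewrite edge_key_swap.
- by rewrite edge_key_swap.
- case: (ltgtP (edge_key p) (edge_key q)) => [?|?|E]; [exact: Or41|exact: Or42|].
  case: p q E => x y [z w] [_ /=].
  case: (leP (phi x) (phi y)) => xy; case: (leP (phi z) (phi w)) => zw.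
  + by move=> /phi_inj -> /phi_inj ->; apply: Or43.
  + by move=> /phi_inj -> /phi_inj ->; apply: Or44.
  + by move=> /phi_inj -> /phi_inj ->; apply: Or44.
  + by move=> /phi_inj -> /phi_inj ->; apply: Or43.
Qed.

Lemma key_ltE p q : key_lt p q -> G p <= G q.
Proof. by rewrite /key_lt ltEprodlexi => /andP[]. Qed.

Lemma measurable_key_lt : measurable [set pq : (J * J) * (J * J) | key_lt pq.1 pq.2].
Proof.
pose b (pq : (J * J) * (J * J)) := (edge_key pq.1 < edge_key pq.2)%O.
suff mb : measurable_fun setT b by have := mb measurableT [set true] I; rewrite setTI.
pose Mx (p : J * J) := Num.max (phi p.1) (phi p.2).
pose mn (p : J * J) := Num.min (phi p.1) (phi p.2).
have m1 : measurable_fun setT (fun p : J * J => phi p.1) by exact: measurableT_comp.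
have m2 : measurable_fun setT (fun p : J * J => phi p.2) by exact: measurableT_comp.
have mMx : measurable_fun setT Mx by exact: measurable_maxr.
have mmn : measurable_fun setT mn by exact: measurable_minr.
have onl (f : J * J -> R) : measurable_fun setT f ->
  measurable_fun setT (fun pq : (J * J) * (J * J) => f pq.1) by move=> mf; exact: measurableT_comp.
have onr (f : J * J -> R) : measurable_fun setT f ->
  measurable_fun setT (fun pq : (J * J) * (J * J) => f pq.2) by move=> mf; exact: measurableT_comp.
have -> : b = fun pq => (G pq.1 <= G pq.2) && ((G pq.2 <= G pq.1) ==>
    ((Mx pq.1 <= Mx pq.2) && ((Mx pq.2 <= Mx pq.1) ==> (mn pq.1 < mn pq.2)))).
  by apply/funext => pq; rewrite /b !ltEprodlexi.
have -> : (fun pq : (J * J) * (J * J) => (G pq.1 <= G pq.2) && ((G pq.2 <= G pq.1) ==>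
    ((Mx pq.1 <= Mx pq.2) && ((Mx pq.2 <= Mx pq.1) ==> (mn pq.1 < mn pq.2))))) =
    fun pq => (G pq.1 <= G pq.2) && (~~ (G pq.2 <= G pq.1) ||
    ((Mx pq.1 <= Mx pq.2) && (~~ (Mx pq.2 <= Mx pq.1) || (mn pq.1 < mn pq.2)))).
  by apply/funext => pq; rewrite !implybE.
apply: measurable_and; first by apply: measurable_fun_ler; [exact: onl|exact: onr].
apply: measurable_or.
  by apply: measurable_neg; apply: measurable_fun_ler; [exact: onr|exact: onl].
apply: measurable_and; first by apply: measurable_fun_ler; [exact: onl|exact: onr].
apply: measurable_or.
  by apply: measurable_neg; apply: measurable_fun_ler; [exact: onr|exact: onl].
by apply: measurable_fun_ltr; [exact: onl|exact: onr].
Qed.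

End EdgeKey.

(** The sum counts the integers from 1 to K that are at most r, hence is the integer part of r. *)
Lemma sum_steps (R : realType) (K : nat) (r : R) : 0 <= r -> r <= K%:R ->
  let c : R := \sum_(k < K) (k.+1%:R <= r)%R%:R in c <= r <= c + 1.
Proof.
rewrite /=; elim: K r => [|K ih] r r0 rK; first by rewrite big_ord0 r0 add0r (le_trans rK).
rewrite big_ord_recl /=; have [r1|r1] := leP 1 r.
  have := ih (r - 1); rewrite (eq_bigr (fun k : 'I_K => ((bump 0 k).+1%:R <= r)%R%:R)).
    rewrite subr_ge0 r1 lerBlDr natr1 rK => /(_ isT isT).
    by rewrite mulr1n; set S := \sum_(_ < _) _; lra.
  by move=> k _; rewrite lerBrDr natr1.
rewrite big1 ?addr0 ?add0r ?r0 ?(ltW r1)// => k _.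
by rewrite leNgt (lt_le_trans r1)// ler1n.
Qed.

Section Exposed.
Context d (J : measurableType d) (R : realType) (mu : probability J R).
Context (phi : J -> R) (adj : J -> J -> Prop) (h : nat -> J -> J) (D : nat).
Local Notation E := (Edir adj).
Hypothesis graphing : enumerated_graphing mu phi adj h D.
Variable nu : {measure set (J * J) -> \bar R}.
Local Open Scope ereal_scope.
Hypothesis nuP : forall f, (forall p, 0 <= f p) -> measurable_fun setT f ->
  \int[nu]_(p in E) f p = \int[mu]_x nbr_sum adj f x.

Let mE := eg_mE graphing.
Local Notation I f := (\int[nu]_(p in E) (f p)%:E).

Variables (a : set (J * J) -> \bar R) (fa : J * J -> R).
Hypotheses (a_bmm : bmm_plus mu adj a) (fa_RN : is_RN_deriv mu adj a fa).

Let mfa : measurable_fun E fa. Proof. by case: fa_RN. Qed.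
Let fa_sym x y : fa (x, y) = fa (y, x). Proof. by case: fa_RN. Qed.
Let aE F : edge_subset adj F -> a F = eta_int mu adj (fun p => \1_F p * fa p)%R.
Proof. by case: fa_RN => _ _; apply. Qed.

Let rank_le1 F : rank mu F <= 1.
Proof.
rewrite /rank -[leRHS]sube0 leeB//; apply: integral_ge0 => x _.
by rewrite lee_fin (@inv_card_ge0 R _ (comp F x)).
Qed.

Let a_ge0 F : edge_subset adj F -> 0 <= a F.
Proof. by case: a_bmm => -[_ /(_ F)] + _ eF => /(_ eF)[]. Qed.

Let a_rank F : edge_subset adj F -> a F <= rank mu F.
Proof. by case: a_bmm => -[_ /(_ F)] + _ eF => /(_ eF)[]. Qed.

Let N1 : set (J * J) := E `&` fa @^-1` `]-oo, 0%R[.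
Let P1 : set (J * J) := E `&` fa @^-1` `[0%R, +oo[.

Let edge_level (f : J * J -> R) (S : set R) : measurable_fun E f ->
  (forall x y, f (x, y) = f (y, x)) -> measurable S ->
  edge_subset adj (E `&` f @^-1` S).
Proof.
move=> mf fs mS; split; first exact: mf.
- by move=> p [].
- by move=> x y [Exy /= Sxy]; split; [exact: (eg_sym graphing)|rewrite /= -fs].
Qed.

Let eN1 : edge_subset adj N1. Proof. by apply: edge_level => //; exact: measurable_itv. Qed.
Let eP1 : edge_subset adj P1. Proof. by apply: edge_level => //; exact: measurable_itv. Qed.

(** The density is given without sign or integrability. Its positive and negative parts live on edge
    sets where the bounds on [a] can be applied. *)
Let f1 p : R := (\1_P1 p * fa p)%R.
Let f2 p : R := (\1_N1 p * - fa p)%R.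

Let mind (S : set (J * J)) : measurable S -> measurable_fun E (\1_S : J * J -> R).
Proof. exact: measurable_indic. Qed.

Let mf1 : measurable_fun E f1.
Proof. by apply: measurable_funM => //; apply: mind; case: eP1. Qed.

Let mf2 : measurable_fun E f2.
Proof.
apply: measurable_funM => //; first by apply: mind; case: eN1.
exact: measurable_funN.
Qed.

Let f1_ge0 p : (0 <= f1 p)%R.
Proof.
rewrite /f1 indicE; case: (boolP (p \in P1)) => [|_]; rewrite ?mul0r// mul1r.
by rewrite inE => -[_ /=]; rewrite in_itv/= andbT.
Qed.

Let f2_ge0 p : (0 <= f2 p)%R.
Proof.
rewrite /f2 indicE; case: (boolP (p \in N1)) => [|_]; rewrite ?mul0r// mul1r.
by rewrite inE => -[_ /=]; rewrite in_itv/= oppr_ge0 => /ltW.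
Qed.

Let fa12 p : E p -> fa p = (f1 p - f2 p)%R.
Proof.
move=> Ep; rewrite /f1 /f2 !indicE; have [fp|fp] := leP 0%R (fa p).
  have -> : p \in P1 by rewrite inE; split=> //=; rewrite in_itv/= fp.
  have -> : (p \in N1) = false.
    by apply/negP; rewrite inE => -[_ /=]; rewrite in_itv/= ltNge fp.
  by rewrite mul1r mul0r subr0.
have -> : p \in N1 by rewrite inE; split=> //=; rewrite in_itv/=.
have -> : (p \in P1) = false.
  by apply/negP; rewrite inE => -[_ /=]; rewrite in_itv/= andbT leNgt fp.
by rewrite mul1r mul0r opprK add0r.
Qed.

(** On the set where the density is negative [a] is non-negative, yet its value there is minus one
    half of this integral. *)
Let If2 : I f2 = 0.
Proof.
have If2_ge0 : 0 <= I f2 by apply: integral_ge0 => p _; rewrite lee_fin.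
apply/eqP; rewrite eq_le If2_ge0 andbT.
have := a_ge0 eN1; rewrite aE//.
have -> : (fun p => \1_N1 p * fa p)%R = (fun p => - f2 p)%R.
  by apply/funext => p; rewrite /f2 mulrN opprK.
by rewrite (eta_int_oppE graphing nuP)// oppe_ge0 pmule_rle0// lte_fin.
Qed.

Let If1_fin : I f1 < +oo.
Proof.
have : 2^-1%:E * I f1 <= 1.
  rewrite -(eta_int_ge0E graphing nuP)//.
  by have := le_trans (a_rank eP1) (rank_le1 P1); rewrite aE.
rewrite ltey; apply: contraTneq => ->.
by rewrite mulry gtr0_sg// mul1e.
Qed.

Let f2_ae : ae_eq nu E (EFin \o f2) (cst 0).
Proof.
apply/(ae_eq_integral_abs nu mE); first exact/measurable_EFinP.
rewrite -If2; apply: eq_integral => p _ /=.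
by rewrite ger0_norm.
Qed.

Let integrable_ge0 (u : J * J -> R) : measurable_fun E u ->
  (forall p, E p -> (0 <= u p)%R) -> I u < +oo -> nu.-integrable E (EFin \o u).
Proof.
move=> mu' u0 fin; apply/integrableP; split; first exact/measurable_EFinP.
apply: le_lt_trans fin; rewrite le_eqVlt; apply/orP; left; apply/eqP.
by apply: eq_integral => p /[!inE] Ep /=; rewrite ger0_norm// u0.
Qed.

Let integrable_ae (u v : J * J -> R) : measurable_fun E v ->
  nu.-integrable E (EFin \o u) -> ae_eq nu E (EFin \o v) (EFin \o u) ->
  nu.-integrable E (EFin \o v) /\ I v = I u.
Proof.
move=> mv iu vu; have mu' := measurable_int _ iu.
split; last by apply: ae_eq_integral => //; exact/measurable_EFinP.
apply/integrableP; split; first exact/measurable_EFinP.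
have /integrableP[_] := iu; apply: le_lt_trans; rewrite le_eqVlt; apply/orP; left; apply/eqP.
apply: ae_eq_integral => //.
- by apply: measurableT_comp => //; exact/measurable_EFinP.
- exact: measurableT_comp.
- by apply: filterS vu => p H Ep; have [vp] := H Ep; rewrite /= vp.
Qed.

(** Off a null set the density equals its positive part, which is integrable. *)
Let a_level L : edge_subset adj L -> a L = 2^-1%:E * I (fun p => f1 p * \1_L p)%R.
Proof.
move=> eL; rewrite aE//; have [mL LE _] := eL.
have iu : nu.-integrable E (EFin \o (fun p => f1 p * \1_L p)%R).
  apply: integrable_ge0.
  - by apply: measurable_funM => //; exact: mind.
  - by move=> p _; rewrite mulr_ge0.
  - apply: le_lt_trans If1_fin; apply: ge0_le_integral => //.
    + by move=> p _; rewrite lee_fin mulr_ge0.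
    + by apply/measurable_EFinP; apply: measurable_funM => //; exact: mind.
    + exact/measurable_EFinP.
    + by move=> p _; rewrite lee_fin ler_piMr// indicE lern1 leq_b1.
have aeL : ae_eq nu E (EFin \o (fun p => \1_L p * fa p)%R)
    (EFin \o (fun p => f1 p * \1_L p)%R).
  apply: filterS f2_ae => p H Ep /=; have [f2p] := H Ep.
  by rewrite fa12// f2p subr0 mulrC.
have [iv IE] := integrable_ae (measurable_funM (mind mL) mfa) iu aeL.
by rewrite (eta_int_integrable graphing nuP iv) IE.
Qed.

Variables (G : J * J -> R) (M : R).
Hypotheses (mG : measurable_fun setT G) (G_sym : forall x y, G (x, y) = G (y, x))
  (G_ge0 : forall p, (0 <= G p)%R) (G_le : forall p, (G p <= M)%R).

Local Notation F := (wired_forest (key_lt phi G) E).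
Local Notation lt_order := (key_lt_order (eg_phi_inj graphing) G_sym).
Local Notation mlt := (measurable_key_lt (eg_mphi graphing) mG).

Let eE := Edir_edge_subset graphing.
Let eF : edge_subset adj F := wired_forest_edge_subset graphing lt_order mlt eE.
Let mF : measurable F. Proof. by case: eF. Qed.
Let FE : F `<=` E. Proof. by case: eF. Qed.

Let I_indic (S : set (J * J)) : measurable S -> S `<=` E -> I (\1_S) = nu S.
Proof. by move=> mS SE; rewrite integral_indic// setIidl. Qed.

Let half2 (x : \bar R) : 2%:E * (2^-1%:E * x) = x.
Proof. by rewrite muleA -EFinM divff// mul1e. Qed.

(** Both are twice the rank of E, as the two measures have full mass. *)
Let I_forest : I (\1_F) = I f1.
Proof.
rewrite I_indic// -[LHS]half2 -(eta_nu graphing nuP eF).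
rewrite -(rank_wired_forest graphing lt_order mlt eE).
case: a_bmm => _ <-; rewrite a_level// half2.
apply: eq_integral => p pE; rewrite indicE pE mulr1//.
Qed.

Let level_le t : I (fun p => f1 p * \1_(E `&` G @^-1` `[t, +oo[) p)%R <=
  I (fun p => \1_F p * \1_(E `&` G @^-1` `[t, +oo[) p)%R.
Proof.
set L := E `&` _.
have eL : edge_subset adj L.
  by apply: edge_level => //; exact: measurable_funTS.
have [mL LE _] := eL.
rewrite -[leLHS]half2 -[leRHS]half2 lee_pmul2l// -a_level//.
apply: le_trans (a_rank eL) _.
rewrite -(forest_measure_upper graphing nuP lt_order mlt eL); last first.
  move=> p q [Ep /=]; rewrite in_itv/= andbT => tp Eq /key_ltE Gpq.
  by split=> //=; rewrite in_itv/= andbT (le_trans tp).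
rewrite (forest_measureE graphing nuP lt_order mlt eL) lee_pmul2l//.
rewrite -I_indic; [|exact: measurableI|by move=> p [/LE]].
rewrite le_eqVlt; apply/orP; left; apply/eqP.
by apply: eq_integral => p _; rewrite indicI mulrC.
Qed.

Let M_ge0 : (0 <= M)%R.
Proof. by have p := (point, point) : J * J; exact: le_trans (G_ge0 p) (G_le p). Qed.

(** A discrete layer cake argument: G exceeds the step function [Gn], a combination of indicators of
    upper level sets, by at most 1/(n+1). [level_le] compares the steps, and the error is at most
    [I f1] / (n+1) <= e. *)
Lemma forest_optimal : I (fun p => f1 p * G p)%R <= I (fun p => \1_F p * G p)%R.
Proof.
apply/lee_addgt0Pr => e e0.
have fin1 : I f1 \is a fin_num.
  by rewrite ge0_fin_numE//; apply: integral_ge0 => p _; rewrite lee_fin.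
pose C := fine (I f1); have CE : I f1 = C%:E by rewrite fineK.
have C0 : (0 <= C)%R by apply: fine_ge0; apply: integral_ge0 => p _; rewrite lee_fin.
have [n nC] : exists n : nat, (C / n.+1%:R <= e)%R.
  exists (Num.bound (C / e)%R); rewrite ler_pdivrMr ?ltr0n// mulrC -ler_pdivrMr//.
  have := archi_boundP (divr_ge0 C0 (ltW e0)) => /ltW/le_trans; apply.
  by rewrite ler_nat.
have n0 : (0 < n.+1%:R :> R)%R by rewrite ltr0n.
(* Enough levels to reach the upper bound M of G, so that no value is truncated. *)
pose K := Num.bound (M * n.+1%:R)%R.
have KM : (M * n.+1%:R <= K%:R)%R by rewrite ltW// archi_boundP// mulr_ge0.
pose L k := E `&` G @^-1` `[(k.+1%:R / n.+1%:R)%R, +oo[.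
have mL k : measurable (L k).
  apply: measurableI => //; rewrite -[X in measurable X]setTI.
  by apply: mG => //; exact: measurable_itv.
pose Gn p : R := (n.+1%:R^-1 * \sum_(k < K) \1_(L k) p)%R.
have GnP p : E p -> (Gn p <= G p <= Gn p + n.+1%:R^-1)%R.
  move=> Ep; have := @sum_steps R K (G p * n.+1%:R).
  rewrite (eq_bigr (fun k : 'I_K => \1_(L k) p)); last first.
    move=> k _; rewrite indicE; congr (nat_of_bool _)%:R.
    rewrite -ler_pdivrMr//; apply/idP/idP.
      by move=> kG; rewrite mem_set//; split=> //=; rewrite in_itv/= andbT.
    by rewrite inE => -[_ /=]; rewrite in_itv/= andbT.
  move=> /(_ _ _)/andP[].
  - by rewrite mulr_ge0.
  - by apply: le_trans KM; rewrite ler_pM2r.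
  - by rewrite /Gn => le1 le2; rewrite ler_pdivrMl// mulrC le1/= -[X in (_ <= _ + X)%R]mulr1 -mulrDr ler_pdivlMl// mulrC.
have mGn : measurable_fun E Gn.
  apply: measurable_funM; first exact: measurable_cst.
  apply: measurable_sum => k; exact: mind (mL k).
have Gn0 p : (0 <= Gn p)%R by rewrite mulr_ge0// sumr_ge0// => k _; rewrite indicE.
have expand (u : J * J -> R) : measurable_fun E u -> (forall p, (0 <= u p)%R) ->
    I (fun p => u p * Gn p)%R = \sum_(k < K) (n.+1%:R^-1)%:E * I (fun p => u p * \1_(L k) p)%R.
  move=> mu' u0.
  have mt k : measurable_fun E (fun p => (u p * \1_(L k) p)%:E).
    by apply/measurable_EFinP; apply: measurable_funM => //; exact: mind.
  have Zl k : (n.+1%:R^-1)%:E * I (fun p => u p * \1_(L k) p)%R =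
      \int[nu]_(p in E) ((n.+1%:R^-1)%:E * (u p * \1_(L k) p)%:E).
    by rewrite ge0_integralZl_EFin// => p _; rewrite lee_fin mulr_ge0.
  rewrite (eq_bigr _ (fun (k : 'I_K) _ => Zl k)) -ge0_integral_sum//; last 2 first.
  - by move=> k; exact: measurable_funeM.
  - by move=> k p _; rewrite -EFinM lee_fin !mulr_ge0.
  apply: eq_integral => p _; rewrite (eq_bigr (fun k : 'I_K =>
    (n.+1%:R^-1 * (u p * \1_(L k) p))%:E)); last by move=> k _; rewrite EFinM.
  by rewrite sumEFin; congr EFin; rewrite /Gn mulrCA !mulr_sumr.
have mfG : measurable_fun E (fun p => (f1 p * Gn p)%:E).
  by apply/measurable_EFinP; exact: measurable_funM.
have mf1' : measurable_fun E (fun p => (f1 p)%:E) by exact/measurable_EFinP.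
apply: (@le_trans _ _ (I (fun p => f1 p * Gn p)%R + (n.+1%:R^-1)%:E * I f1)).
  rewrite -ge0_integralZl_EFin//; last by move=> p _; rewrite lee_fin.
  rewrite -ge0_integralD//; last 3 first.
  - by move=> p _; rewrite lee_fin mulr_ge0.
  - by move=> p _; rewrite -EFinM lee_fin mulr_ge0.
  - exact: measurable_funeM.
  apply: ge0_le_integral => //.
  - by move=> p _; rewrite lee_fin mulr_ge0.
  - by apply/measurable_EFinP; apply: measurable_funM => //; exact: measurable_funTS.
  - by apply: emeasurable_funD => //; exact: measurable_funeM.
  - move=> p Ep; rewrite -EFinM -EFinD lee_fin [(_^-1 * _)%R]mulrC -mulrDr ler_wpM2l//.
    by have /andP[] := GnP p Ep.
apply: leeD; last first.
  by rewrite CE -EFinM lee_fin mulrC.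
apply: (@le_trans _ _ (I (fun p => \1_F p * Gn p)%R)).
  rewrite (expand _ mf1 f1_ge0) (expand _ (mind mF))//.
  by apply: lee_sum => k _; rewrite lee_pmul2l ?lte_fin ?invr_gt0//; exact: level_le.
apply: ge0_le_integral => //.
- by move=> p _; rewrite lee_fin mulr_ge0.
- by apply/measurable_EFinP; apply: measurable_funM => //; exact: mind.
- by apply/measurable_EFinP; apply: measurable_funM; [exact: mind|exact: measurable_funTS].
- move=> p Ep; rewrite lee_fin ler_wpM2l//.
  by have /andP[] := GnP p Ep.
Qed.

Variables (g : J * J -> R) (c : R) (N : set (J * J)).
Hypotheses (mg : measurable_fun E g) (eN : edge_subset adj N) (N0 : eta mu N = 0)
  (gG : forall p, E p -> ~ N p -> G p = (g p + c)%R).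

Let N_ae : {ae nu, forall p, ~ N p}.
Proof.
exists N; split; first by case: eN.
  by rewrite -[LHS]half2 -(eta_nu graphing nuP eN) N0 mule0.
by move=> p /= /contrapT.
Qed.

Let eta_int_mulg (v u : J * J -> R) : measurable_fun E v -> measurable_fun E u ->
  (forall p, (0 <= u p)%R) -> I u < +oo -> ae_eq nu E (EFin \o v) (EFin \o u) ->
  eta_int mu adj (fun p => v p * g p)%R =
  2^-1%:E * (I (fun p => u p * G p)%R - c%:E * I u).
Proof.
move=> mv mu' u0 Iu vu.
have mGE : measurable_fun E G by exact: measurable_funTS.
have iu := integrable_ge0 mu' (fun p _ => u0 p) Iu.
have iuG : nu.-integrable E (EFin \o (fun p => u p * G p)%R).
  apply: (@le_integrable _ _ _ nu _ mE _ (EFin \o (fun p => M * u p)%R)).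
  - by apply/measurable_EFinP; exact: measurable_funM.
  - move=> p _ /=; rewrite lee_fin ger0_norm ?mulr_ge0// ger0_norm ?mulr_ge0//.
    by rewrite mulrC ler_wpM2r.
  - rewrite (_ : EFin \o _ = fun p => M%:E * (EFin \o u) p); first exact: integrableZl.
    by apply/funext => p; rewrite /= EFinM.
have icu : nu.-integrable E (EFin \o (fun p => c * u p)%R).
  rewrite (_ : EFin \o _ = fun p => c%:E * (EFin \o u) p); first exact: integrableZl.
  by apply/funext => p; rewrite /= EFinM.
have ik : nu.-integrable E (EFin \o (fun p => u p * G p - c * u p)%R).
  rewrite (_ : EFin \o _ = (EFin \o (fun p => u p * G p)%R) \- (EFin \o (fun p => c * u p)%R)).
    exact: integrableB.
  by apply/funext => p.
have ae : ae_eq nu E (EFin \o (fun p => v p * g p)%R)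
    (EFin \o (fun p => u p * G p - c * u p)%R).
  apply: filterS2 N_ae vu => p nNp H Ep /=; have [->] := H Ep.
  by rewrite (gG Ep nNp) mulrDr [(c * _)%R]mulrC addrK.
have [iv Iv] := integrable_ae (measurable_funM mv mg) ik ae.
rewrite (eta_int_integrable graphing nuP iv) Iv; congr (_ * _).
under eq_integral do rewrite EFinB.
rewrite integralB_EFin//; congr (_ - _).
by under eq_integral do rewrite EFinM; rewrite integralZl.
Qed.

(** Replacing g by G = g + c changes both sides by c times the same total mass, by [I_forest], so
    the comparison reduces to [forest_optimal]. *)
Lemma forest_maximizes : eta_int mu adj (fun p => fa p * g p)%R <=
  eta_int mu adj (fun p => \1_F p * g p)%R.
Proof.
have ae1 : ae_eq nu E (EFin \o fa) (EFin \o f1).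
  apply: filterS f2_ae => p H Ep /=; have [f2p] := H Ep.
  by rewrite fa12// f2p subr0.
rewrite (eta_int_mulg mfa mf1 f1_ge0 If1_fin ae1).
have IF_fin : I (\1_F) < +oo by rewrite I_forest.
rewrite (eta_int_mulg (mind mF) (mind mF) _ IF_fin (ae_eq_refl _ _ _))//.
rewrite I_forest lee_pmul2l ?lte_fin//; apply: leeB => //; exact: forest_optimal.
Qed.

End Exposed.

Theorem theorem4p2 (d : measure_display) (J : measurableType d) (R : realType)
  (mu : probability J R) (adj : J -> J -> Prop)
  (a : set (J * J) -> \bar R) (fa : J * J -> R) (g : J * J -> R) :
  is_graphing mu adj ->
  bmm_plus mu adj a ->
  is_RN_deriv mu adj a fa ->
  Linfty_E mu adj g ->
  (forall (b : set (J * J) -> \bar R) (fb : J * J -> R),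
      bmm_plus mu adj b -> is_RN_deriv mu adj b fb ->
      ~ eta_ae mu adj (fun p => fb p = fa p) ->
      (eta_int mu adj (fun p => (fb p * g p)%R) < eta_int mu adj (fun p => (fa p * g p)%R))%E) ->
  eta_ae mu adj (fun p => fa p = 0 \/ fa p = 1).
Proof.
move=> [[phi [mphi phi_inj _ mimg]] [mE adj_sym] adj_irr [D degD] balanced].
move=> a_bmm fa_RN [mg g_sym [M0 [N [eN N0 gM]]]] exposed.
have [h [mh h_cover]] := lusin_novikov mphi phi_inj mimg mE degD.
have graphing : enumerated_graphing mu phi adj h D by split.
have [nu nuP] := nbr_sum_measure graphing.
(* The essential bound may be negative when the edge set is null. *)
pose M1 := Num.max M0 0.
have M1_ge0 : 0 <= M1 by rewrite le_max lexx orbT.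
(* Truncating g, extending it by 0 off E and shifting by [M1] gives a function with values in
   [0, 2 M1] everywhere, equal to g + M1 on E outside the null set N. *)
pose G p := Num.max (- M1) (Num.min M1 ((g \_ (Edir adj)) p)) + M1.
have mG : measurable_fun setT G.
  apply: measurable_funD => //; apply: measurable_maxr => //.
  by apply: measurable_minr => //; apply/(measurable_restrictT g mE).
have G_sym x y : G (x, y) = G (y, x).
  rewrite /G; have -> // : (g \_ (Edir adj)) (x, y) = (g \_ (Edir adj)) (y, x).
  rewrite !patchE g_sym; have -> // : ((x, y) \in Edir adj) = ((y, x) \in Edir adj).
  by apply/idP/idP; rewrite !inE => /adj_sym.
have G_ge0 p : 0 <= G p by rewrite -lerBlDr sub0r le_max lexx.
have G_le p : G p <= M1 + M1.
  by rewrite lerD2r ge_max ge_min lexx (le_trans _ M1_ge0)// oppr_le0.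
have gG p : Edir adj p -> ~ N p -> G p = g p + M1.
  move=> Ep nNp; rewrite /G patchE mem_set//.
  have : `|g p| <= M1 by rewrite le_max gM.
  by rewrite ler_norml => /andP[gl gr]; rewrite min_r// max_r.
have lt_order := key_lt_order phi_inj G_sym.
have mlt := measurable_key_lt mphi mG.
pose F := wired_forest (key_lt phi G) (Edir adj).
have [mF FE sF] : edge_subset adj F :=
  wired_forest_edge_subset graphing lt_order mlt (Edir_edge_subset graphing).
(* If the two densities differ, exposure makes the given one strictly better than the forest,
   against [forest_maximizes]. *)
have [[N' [eN' N'0 FN']]|nae] := pselect (eta_ae mu adj (fun p => \1_F p = fa p)).
  exists N'; split=> // p Ep nN'p; rewrite -(FN' p Ep nN'p) indicE.
  by case: (p \in F); [right|left].
have RN : is_RN_deriv mu adj (forest_measure mu adj (key_lt phi G)) \1_F.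
  split=> // x y; rewrite !indicE; congr (nat_of_bool _)%:R.
  by apply/idP/idP; rewrite !inE => /sF.
have := exposed _ _ (forest_measure_bmm graphing nuP lt_order mlt) RN nae.
rewrite ltNge => /negP[].
exact: (forest_maximizes graphing nuP a_bmm fa_RN mG G_sym G_ge0 G_le mg eN N0 gG).
Qed.
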